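(* Let $a<c<d<b$, and let $\mathcal P: c=x_0<x_1<\dots<x_m=d$ be a partition of $[c,d]$ into $m$ subintervals. Then $\operatorname{rank}\mathcal F_{\mathcal P}\le m$, and $$\|\mathcal H_2^{c,d}-\mathcal F_{\mathcal P}\|\le E_{c,d}(\mathcal P).$$ Consequently, for every $\varepsilon>0$ there are a partition $\mathcal P$ of $[c,d]$ and a bounded finite-rank bilinear map $\mathcal F_{\mathcal P}$ such that $\|\mathcal H_2^{c,d}-\mathcal F_{\mathcal P}\|<\varepsilon$. If, in addition, $\mathcal H_2:X_1\times X_2\to Y$ is bounded, then for the full operator $$a_{m+1}^{(2)}(\mathcal H_2)\le\big(\gamma(c,d)^q+E_{c,d}(\mathcal P)^q\big)^{1/q}.$$ In particular, if $\mathcal P_m$ is the uniform partition of $[c,d]$ into $m$ subintervals, then $$a_{m+1}^{(2)}(\mathcal H_2)\le\Big[\gamma(c,d)^q+U_{c,d}\Big(M_1\,\omega_2\big(\tfrac{d-c}{m}\big)+M_2\,\omega_1\big(\tfrac{d-c}{m}\big)\Big)^q\Big]^{1/q}.$$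
   Context: Let $-\infty\le a<b\le\infty$, $I=(a,b)$, $1<p_1,p_2<\infty$, $0<q<\infty$, $1/p_i+1/p_i'=1$. Let $v_1,v_2$ be measurable on $I$, positive and finite a.e., and let $u\ge0$ be measurable with $u\in L^1_{\mathrm{loc}}(I)$. Assume $V_i(x):=\int_a^x v_i(t)^{1-p_i'}\,dt<\infty$ for all $x\in I$, $i=1,2$. Put $X_i=L^{p_i}(v_i;I)$ with $\|f\|_{X_i}=(\int_I|f|^{p_i}v_i\,dx)^{1/p_i}$ and $Y=L^q(u;I)$ with $\|h\|_Y=(\int_I|h|^qu\,dx)^{1/q}$ (real or complex functions, identified when equal a.e. for the relevant measure). Define $Hf(x)=\int_a^xf(t)\,dt$, $\mathcal H_2(f,g)(x)=Hf(x)\,Hg(x)$, and $\mathcal H_2^{c,d}(f,g)=\chi_{(c,d)}\mathcal H_2(f,g)$. A bilinear map $T:X_1\times X_2\to Y$ is bounded if $\|T\|:=\sup_{\|f\|_{X_1}\le1,\|g\|_{X_2}\le1}\|T(f,g)\|_Y<\infty$. It is finite-rank if the linear span of its range is finite-dimensional; $\operatorname{rank}T$ is the dimension of that span. For $n\ge1$, $a_n^{(2)}(T)=\inf\{\|T-F\|: F \text{ bounded finite-rank bilinear},\ \operatorname{rank}F<n\}$. For $\mathcal P: c=x_0<\dots<x_m=d$ put $|\mathcal P|=\max_j(x_{j+1}-x_j)$ and $$\mathcal F_{\mathcal P}(f,g)(x)=\sum_{j=0}^{m-1}Hf(x_j)\,Hg(x_j)\,\chi_{[x_j,x_{j+1})}(x).$$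 Also $U_{c,d}=\int_c^du(x)\,dx$, $M_i=V_i(d)^{1/p_i'}$, $$\omega_i(\delta)=\sup\Big\{\Big(\int_x^yv_i(t)^{1-p_i'}\,dt\Big)^{1/p_i'}: c\le x\le y\le d,\ y-x\le\delta\Big\},$$ $$E_{c,d}(\mathcal P)=U_{c,d}^{1/q}\big(M_1\,\omega_2(|\mathcal P|)+M_2\,\omega_1(|\mathcal P|)\big),$$ and $\gamma(c,d)=\|\chi_{(a,c)\cup(d,b)}\mathcal H_2\|$ when $\mathcal H_2$ is bounded. *)

(* Defs.v *)
From HB Require Import structures.
From mathcomp Require Import all_boot all_order all_algebra.
From mathcomp Require Import complex.
From mathcomp Require Import all_classical all_reals all_analysis.
From mathcomp Require Import measurable_realfun.
Set Implicit Arguments.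
Unset Strict Implicit.
Unset Printing Implicit Defensive.
Import Order.TTheory GRing.Theory Num.Theory.
Import numFieldNormedType.Exports.
Local Open Scope classical_set_scope.
Local Open Scope ring_scope.

(* The function spaces may be real or complex: every notion below is stated
   over [scalars R k], which is R or R[i]. *)
Inductive scalar_kind := Reals | Complexes.

Definition scalars (R : realType) (k : scalar_kind) : fieldType :=
  match k with Reals => R | Complexes => R[i] end.

Definition scalar_abs (R : realType) (k : scalar_kind) : scalars R k -> R :=
  match k with
  | Reals => fun z => `|z|
  | Complexes => fun z => Normc.normc z
  end.

Definition scalar_re (R : realType) (k : scalar_kind) : scalars R k -> R :=
  match k with Reals => fun z => z | Complexes => fun z => complex.Re z end.

Definition scalar_im (R : realType) (k : scalar_kind) : scalars R k -> R :=
  match k with Reals => fun=> 0 | Complexes => fun z => complex.Im z end.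

Definition scalar_mk (R : realType) (k : scalar_kind) : R -> R -> scalars R k :=
  match k with Reals => fun x _ => x | Complexes => fun x y => Complex x y end.

Definition scalar_measurable (R : realType) (k : scalar_kind) (D : set R)
    (f : R -> scalars R k) : Prop :=
  measurable_fun D (fun x => scalar_re (f x)) /\
  measurable_fun D (fun x => scalar_im (f x)).

Definition scalar_integral (R : realType) (k : scalar_kind) (D : set R)
    (f : R -> scalars R k) : scalars R k :=
  scalar_mk k (\int[lebesgue_measure]_(t in D) scalar_re (f t))
              (\int[lebesgue_measure]_(t in D) scalar_im (f t)).

Definition eitv (R : realType) (a b : \bar R) : set R :=
  [set x : R | (a < x%:E < b)%E].

(* Weighted spaces L^p(w; I).  Elements are represented by functions; the
   identification of functions that agree almost everywhere is [wLp_eq].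
   Weights take extended real values, as they may be infinite on a null set. *)
Record wLp (R : realType) := WLp {
  wLp_dom : set R;
  wLp_exp : R;
  wLp_weight : R -> \bar R
}.

Definition wLp_norm (R : realType) (k : scalar_kind) (X : wLp R)
    (f : R -> scalars R k) : \bar R :=
  ((\int[lebesgue_measure]_(x in wLp_dom X)
      ((scalar_abs (f x) `^ wLp_exp X)%:E * wLp_weight X x)) `^
    (wLp_exp X)^-1)%E.

Definition in_wLp (R : realType) (k : scalar_kind) (X : wLp R)
    (f : R -> scalars R k) : Prop :=
  scalar_measurable (wLp_dom X) f /\ (wLp_norm X f < +oo)%E.

(* f = g almost everywhere on I for the measure w dx (not for Lebesgue measure,
   which matters where w vanishes). *)
Definition wLp_eq (R : realType) (k : scalar_kind) (X : wLp R)
    (f g : R -> scalars R k) : Prop :=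
  exists N : set R, [/\ measurable N,
    (\int[lebesgue_measure]_(x in N `&` wLp_dom X) wLp_weight X x = 0)%E &
    forall x, wLp_dom X x -> f x <> g x -> N x].

(* A bilinear map X1 x X2 -> Y of the quotient spaces, given on representatives. *)
Record bilinear_map (R : realType) (k : scalar_kind) (X1 X2 Y : wLp R)
    (T : (R -> scalars R k) -> (R -> scalars R k) -> R -> scalars R k) : Prop := {
  bilinear_map_in : forall f g, in_wLp X1 f -> in_wLp X2 g -> in_wLp Y (T f g);
  bilinear_map_eq : forall f f' g g',
    in_wLp X1 f -> in_wLp X1 f' -> in_wLp X2 g -> in_wLp X2 g' ->
    wLp_eq X1 f f' -> wLp_eq X2 g g' -> wLp_eq Y (T f g) (T f' g');
  bilinear_map_l : forall (s : scalars R k) f f' g,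
    in_wLp X1 f -> in_wLp X1 f' -> in_wLp X2 g ->
    wLp_eq Y (T (fun x => s * f x + f' x) g)
             (fun x => s * T f g x + T f' g x);
  bilinear_map_r : forall (s : scalars R k) f g g',
    in_wLp X1 f -> in_wLp X2 g -> in_wLp X2 g' ->
    wLp_eq Y (T f (fun x => s * g x + g' x))
             (fun x => s * T f g x + T f g' x)
}.

Definition bilinear_norm (R : realType) (k : scalar_kind) (X1 X2 Y : wLp R)
    (T : (R -> scalars R k) -> (R -> scalars R k) -> R -> scalars R k) : \bar R :=
  ereal_sup [set z | exists f g, [/\ in_wLp X1 f, in_wLp X2 g,
    (wLp_norm X1 f <= 1)%E, (wLp_norm X2 g <= 1)%E & z = wLp_norm Y (T f g)]].

Definition bounded_bilinear (R : realType) (k : scalar_kind) (X1 X2 Y : wLp R)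
    (T : (R -> scalars R k) -> (R -> scalars R k) -> R -> scalars R k) : Prop :=
  bilinear_map X1 X2 Y T /\ (bilinear_norm X1 X2 Y T < +oo)%E.

Definition range_span (R : realType) (k : scalar_kind) (X1 X2 : wLp R)
    (T : (R -> scalars R k) -> (R -> scalars R k) -> R -> scalars R k) :
    set (R -> scalars R k) :=
  [set h | exists (n : nat) (s : 'I_n -> scalars R k)
             (f g : 'I_n -> R -> scalars R k),
     (forall i, in_wLp X1 (f i) /\ in_wLp X2 (g i)) /\
     h = fun x => \sum_(i < n) s i * T (f i) (g i) x].

(* The span of the range, as a subspace of Y, has a basis of r elements:
   independence and generation are both modulo [wLp_eq Y]. *)
Definition has_rank (R : realType) (k : scalar_kind) (X1 X2 Y : wLp R)
    (T : (R -> scalars R k) -> (R -> scalars R k) -> R -> scalars R k)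
    (r : nat) : Prop :=
  exists e : 'I_r -> R -> scalars R k,
  [/\ forall i, range_span X1 X2 T (e i),
      forall s : 'I_r -> scalars R k,
        wLp_eq Y (fun x => \sum_(i < r) s i * e i x) (fun=> 0) ->
        forall i, s i = 0 &
      forall h, range_span X1 X2 T h -> exists s : 'I_r -> scalars R k,
        wLp_eq Y h (fun x => \sum_(i < r) s i * e i x)].

Definition finite_rank (R : realType) (k : scalar_kind) (X1 X2 Y : wLp R)
    (T : (R -> scalars R k) -> (R -> scalars R k) -> R -> scalars R k) : Prop :=
  exists r, has_rank X1 X2 Y T r.

Definition bilinear_sub (R : realType) (k : scalar_kind)
    (T F : (R -> scalars R k) -> (R -> scalars R k) -> R -> scalars R k) :=
  fun f g x => T f g x - F f g x.

Definition approx_number (R : realType) (k : scalar_kind) (X1 X2 Y : wLp R)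
    (n : nat)
    (T : (R -> scalars R k) -> (R -> scalars R k) -> R -> scalars R k) : \bar R :=
  ereal_inf [set z | exists F, [/\ bounded_bilinear X1 X2 Y F,
    exists2 r, has_rank X1 X2 Y F r & (r < n)%N &
    z = bilinear_norm X1 X2 Y (bilinear_sub T F)]].

Definition hardy (R : realType) (k : scalar_kind) (a : \bar R)
    (f : R -> scalars R k) (x : R) : scalars R k :=
  scalar_integral (eitv a x%:E) f.

Definition hardy2 (R : realType) (k : scalar_kind) (a : \bar R)
    (f g : R -> scalars R k) (x : R) : scalars R k :=
  hardy a f x * hardy a g x.

Definition hardy2_on (R : realType) (k : scalar_kind) (a : \bar R) (D : set R)
    (f g : R -> scalars R k) (x : R) : scalars R k :=
  \1_D x * hardy2 a f g x.

(* A partition c = x_0 < ... < x_m = d is the sequence s = [:: x_1; ...; x_m]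
   with [itv_partition c d s], so that m = size s. *)
Definition node (R : realType) (c : R) (s : seq R) (j : nat) : R :=
  nth c (c :: s) j.

Definition mesh (R : realType) (c : R) (s : seq R) : R :=
  \big[Num.max/0]_(j < size s) (node c s j.+1 - node c s j).

Definition step_map (R : realType) (k : scalar_kind) (a : \bar R) (c : R)
    (s : seq R) (f g : R -> scalars R k) (x : R) : scalars R k :=
  \sum_(j < size s) hardy a f (node c s j) * hardy a g (node c s j) *
    \1_(`[node c s j, node c s j.+1[%classic) x.

(* Pitfall: +oo to a negative power is +oo in the library; harmless here, as v is
   positive and finite almost everywhere. *)
Definition dual_mass (R : realType) (p' : R) (v : R -> \bar R) (D : set R) :
    \bar R :=
  (\int[lebesgue_measure]_(t in D) (v t `^ (1 - p')))%E.

Definition modulus (R : realType) (p' : R) (v : R -> \bar R) (c d delta : R) :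
    \bar R :=
  ereal_sup [set z | exists x y : R, [/\ c <= x, x <= y, y <= d,
    y - x <= delta & z = (dual_mass p' v `]x, y[%classic `^ p'^-1)%E]].

Definition Vfun (R : realType) (a : \bar R) (p' : R) (v : R -> \bar R) (x : R) :
    \bar R :=
  dual_mass p' v (eitv a x%:E).

Definition Umass (R : realType) (u : R -> R) (c d : R) : \bar R :=
  (\int[lebesgue_measure]_(x in `]c, d[%classic) (u x)%:E)%E.

(* M_1 ω_2(δ) + M_2 ω_1(δ) *)
Definition oscillation (R : realType) (a : \bar R) (p1' p2' : R)
    (v1 v2 : R -> \bar R) (c d delta : R) : \bar R :=
  (Vfun a p1' v1 d `^ p1'^-1 * modulus p2' v2 c d delta +
   Vfun a p2' v2 d `^ p2'^-1 * modulus p1' v1 c d delta)%E.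

Definition Ebound (R : realType) (a : \bar R) (p1' p2' q : R)
    (v1 v2 : R -> \bar R) (u : R -> R) (c d : R) (s : seq R) : \bar R :=
  (Umass u c d `^ q^-1 * oscillation a p1' p2' v1 v2 c d (mesh c s))%E.

Definition gamma_tail (R : realType) (k : scalar_kind) (a b : \bar R)
    (X1 X2 Y : wLp R) (c d : R) : \bar R :=
  bilinear_norm X1 X2 Y
    (@hardy2_on R k a (eitv a c%:E `|` eitv d%:E b)).

(* Main.v *)
Require Import Defs.
From mathcomp Require Import all_boot all_order all_algebra.
From mathcomp Require Import complex.
From mathcomp Require Import all_classical all_reals all_analysis.
From mathcomp Require Import measurable_realfun.
From mathcomp Require Import ring lra.
Set Implicit Arguments.
Unset Strict Implicit.
Unset Printing Implicit Defensive.
Import Order.TTheory GRing.Theory Num.Theory.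
Import numFieldNormedType.Exports.
Local Open Scope classical_set_scope.
Local Open Scope ring_scope.

(** By Hoelder's inequality, a function f of norm at most 1 in L^p(v; I)
    satisfies |Hf(x) - Hf(y)| <= (\int_y^x v^(1-p'))^(1/p') and
    |Hf(x)| <= V(d)^(1/p') for y <= x <= d.  On a cell [x_j, x_(j+1)[ the error
    Hf(x)Hg(x) - Hf(x_j)Hg(x_j) is therefore at most M_1 w_2 + M_2 w_1, and
    integrating its q-th power against u over ]c, d[ gives E_{c,d}.  The moduli
    w_i tend to 0 by absolute continuity of the integral.  The range of the step
    map is spanned by the m indicators of the cells.  Finally |H_2 - F_P|^q
    splits into its integrals outside and inside ]c, d[, which needs no triangle
    inequality in L^q and hence covers 0 < q < 1. *)

(** Three obstacles shape the proof. Hoelder's inequality and the absolute continuity of the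
    integral are applied to real-valued functions, whereas a weight v may be 0, infinite or even
    negative on a null set; that set is cut out of every integral first. Next, equality in Y is
    relative to u dx: the indicator of a cell on which u vanishes is zero in Y, so no basis of the
    span of the range can be read off from the cells, and the rank has to be found as the size of a
    maximal independent family. Finally, H_2 may be unbounded, so everything about chi_(c,d) H_2 is
    derived from bounds on [c, d], where the V_i are at most V_i(d) and u has finite mass because a
    < c and d < b. The error is estimated with the moduli taken at an arbitrary r above the mesh.
    The choice r = |P| gives E_{c,d}(P), and r = (d - c)/m gives the bound for the uniform
    partition. *)

Section integrable_real.
Context (R : realType).
Notation mu := (@lebesgue_measure R).
Implicit Types (D : set R) (f g : R -> R).

Lemma integrable_scale D (c : R) f : measurable D ->
  mu.-integrable D (EFin \o f) -> mu.-integrable D (EFin \o (fun x => c * f x)).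
Proof.
move=> mD ih.
rewrite (_ : _ \o _ = (fun x => c%:E * (f x)%:E)%E); last first.
  by apply/funext => x; rewrite /= EFinM.
exact: integrableZl.
Qed.

Lemma integrable_add D f g : measurable D ->
  mu.-integrable D (EFin \o f) -> mu.-integrable D (EFin \o g) ->
  mu.-integrable D (EFin \o (fun x => f x + g x)).
Proof.
move=> mD fi gi.
rewrite (_ : _ \o _ = (EFin \o f) \+ (EFin \o g))%E; last first.
  by apply/funext => x; rewrite /= EFinD.
exact: integrableD.
Qed.

Lemma integrable_sub D f g : measurable D ->
  mu.-integrable D (EFin \o f) -> mu.-integrable D (EFin \o g) ->
  mu.-integrable D (EFin \o (fun x => f x - g x)).
Proof.
move=> mD fi gi.
rewrite (_ : _ \o _ = (EFin \o f) \- (EFin \o g))%E; last first.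
  by apply/funext => x; rewrite /= EFinB.
exact: integrableB.
Qed.
End integrable_real.

(** * Real and complex scalars *)

Section scalars.
Context (R : realType) (k : scalar_kind).
Implicit Types (z w s : scalars R k) (f g : R -> scalars R k) (D : set R).
Notation mu := (@lebesgue_measure R).

Lemma scalar_abs_ge0 z : 0 <= scalar_abs z.
Proof. by case: k z => //= -[x y]; exact: sqrtr_ge0. Qed.

Lemma scalar_abs0 : scalar_abs (0 : scalars R k) = 0.
Proof. by case: k => /=; [exact: normr0|exact: Normc.normc0]. Qed.

Lemma scalar_absM z w : scalar_abs (z * w) = scalar_abs z * scalar_abs w.
Proof. by case: k z w => z w /=; rewrite ?normrM ?Normc.normcM. Qed.

Lemma scalar_absD z w : scalar_abs (z + w) <= scalar_abs z + scalar_abs w.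
Proof. by case: k z w => z w /=; [exact: ler_normD|exact: le_normcD]. Qed.

Lemma scalar_re_le z : `|scalar_re z| <= scalar_abs z.
Proof.
case: k z => //= -[x y] /=; rewrite -sqrtr_sqr ler_wsqrtr//.
by rewrite lerDl sqr_ge0.
Qed.

Lemma scalar_im_le z : `|scalar_im z| <= scalar_abs z.
Proof.
case: k z => /= [z|[x y] /=]; first by rewrite normr0.
by rewrite -sqrtr_sqr ler_wsqrtr// lerDr sqr_ge0.
Qed.

Lemma scalar_absE z :
  scalar_abs z = Num.sqrt (scalar_re z ^+ 2 + scalar_im z ^+ 2).
Proof.
by case: k z => /= [z|[x y]//]; rewrite expr0n addr0 sqrtr_sqr.
Qed.

Lemma scalar_reD z w : scalar_re (z + w) = scalar_re z + scalar_re w.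
Proof. by case: k z w => //= -[x y] [x' y']. Qed.

Lemma scalar_imD z w : scalar_im (z + w) = scalar_im z + scalar_im w.
Proof. by case: k z w => /= [z w|[x y] [x' y']//]; rewrite addr0. Qed.

(** For real scalars the imaginary part is 0, so the complex product formula covers both kinds, and
    products can be handled part by part without a case distinction. *)
Lemma scalar_reM z w :
  scalar_re (z * w) = scalar_re z * scalar_re w - scalar_im z * scalar_im w.
Proof. by case: k z w => /= [z w|[x y] [x' y']//]; rewrite mul0r subr0. Qed.

Lemma scalar_imM z w :
  scalar_im (z * w) = scalar_re z * scalar_im w + scalar_im z * scalar_re w.
Proof.
by case: k z w => /= [z w|[x y] [x' y']//]; rewrite mulr0 mul0r addr0.
Qed.

(** An indicator is [(x \in A)%:R]; this lemma and the next give its two parts. *)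
Lemma scalar_re_nat n : scalar_re (n%:R : scalars R k) = n%:R.
Proof. by case: k => //=; elim: n => //= n ih; rewrite -[n.+1]addn1 !natrD raddfD/= ih. Qed.

Lemma scalar_im_nat n : scalar_im (n%:R : scalars R k) = 0.
Proof. by case: k => //=; elim: n => //= n ih; rewrite -[n.+1]addn1 natrD raddfD/= ih addr0. Qed.

Lemma scalar_eqP z w :
  scalar_re z = scalar_re w -> scalar_im z = scalar_im w -> z = w.
Proof. by case: k z w => //= -[x y] [x' y'] /= -> ->. Qed.

Lemma scalar_reN z : scalar_re (- z) = - scalar_re z.
Proof. by case: k z => //= -[]. Qed.

Lemma scalar_imN z : scalar_im (- z) = - scalar_im z.
Proof. by case: k z => /= [|[]//]; rewrite oppr0. Qed.

Lemma scalar_re_integral D f :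
  scalar_re (scalar_integral D f) = (\int[mu]_(t in D) scalar_re (f t))%R.
Proof. by rewrite /scalar_integral; case: k f. Qed.

Lemma scalar_im_integral D f :
  scalar_im (scalar_integral D f) = (\int[mu]_(t in D) scalar_im (f t))%R.
Proof.
rewrite /scalar_integral; case: k f => //= f.
by rewrite /Rintegral integral0.
Qed.

Lemma scalar_measurable_abs D f :
  scalar_measurable D f -> measurable_fun D (fun x => scalar_abs (f x)).
Proof.
move=> [mr mi]; under eq_fun do rewrite scalar_absE.
apply: (measurableT_comp (continuous_measurable_fun (@sqrt_continuous R))).
by apply: measurable_funD; exact: measurable_funX.
Qed.

Lemma scalar_measurableD D f g : scalar_measurable D f ->
  scalar_measurable D g -> scalar_measurable D (fun x => f x + g x).
Proof.
move=> [fr fi] [gr gi]; split.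
  by under eq_fun do rewrite scalar_reD; exact: measurable_funD.
by under eq_fun do rewrite scalar_imD; exact: measurable_funD.
Qed.

Lemma scalar_measurableN D f : scalar_measurable D f ->
  scalar_measurable D (fun x => - f x).
Proof.
move=> [fr fi]; split.
  by under eq_fun do rewrite scalar_reN; exact: measurableT_comp.
by under eq_fun do rewrite scalar_imN; exact: measurableT_comp.
Qed.

Lemma scalar_measurableM D f g : scalar_measurable D f ->
  scalar_measurable D g -> scalar_measurable D (fun x => f x * g x).
Proof.
move=> [fr fi] [gr gi]; split.
  under eq_fun do rewrite scalar_reM.
  by apply: measurable_funB; exact: measurable_funM.
under eq_fun do rewrite scalar_imM.
by apply: measurable_funD; exact: measurable_funM.
Qed.

Lemma scalar_measurable_cst D z : scalar_measurable D (fun=> z).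
Proof. by split; exact: measurable_cst. Qed.

Lemma scalar_measurable_indic D (A : set R) : measurable A ->
  scalar_measurable D (fun x => \1_A x : scalars R k).
Proof.
move=> mA; split.
  under eq_fun do rewrite /indic scalar_re_nat.
  exact: measurable_indic.
by under eq_fun do rewrite /indic scalar_im_nat; exact: measurable_cst.
Qed.

Lemma scalar_measurable_sum D n (F : 'I_n -> R -> scalars R k) :
  (forall i, scalar_measurable D (F i)) ->
  scalar_measurable D (fun x => \sum_(i < n) F i x).
Proof.
elim: n F => [|n ih] F mF.
  by under eq_fun do rewrite big_ord0; exact: scalar_measurable_cst.
under eq_fun do rewrite big_ord_recr.
by apply: scalar_measurableD => //; apply: ih.
Qed.

Definition scalar_integrable D f :=
  mu.-integrable D (fun x => (scalar_re (f x))%:E) /\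
  mu.-integrable D (fun x => (scalar_im (f x))%:E).

Lemma scalar_integrableP D f : measurable D -> scalar_measurable D f ->
  (\int[mu]_(t in D) (scalar_abs (f t))%:E < +oo)%E -> scalar_integrable D f.
Proof.
move=> mD [mr mi] foo.
have ia : mu.-integrable D (fun x => (scalar_abs (f x))%:E).
  apply/integrableP; split.
    by apply/measurable_EFinP; exact: scalar_measurable_abs.
  by under eq_integral do rewrite gee0_abs ?lee_fin ?scalar_abs_ge0//.
split; apply: (le_integrable _ _ _ ia) => //.
- by apply/measurable_EFinP.
- move=> x _; rewrite /= lee_fin [leRHS]ger0_norm ?scalar_abs_ge0//.
  exact: scalar_re_le.
- by apply/measurable_EFinP.
- move=> x _; rewrite /= lee_fin [leRHS]ger0_norm ?scalar_abs_ge0//.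
  exact: scalar_im_le.
Qed.

Lemma eq_scalar_integral_ae D f g (N : set R) : measurable D -> measurable N ->
  mu (N `&` D) = 0%E -> scalar_measurable D f -> scalar_measurable D g ->
  (forall x, D x -> f x <> g x -> N x) ->
  scalar_integral D f = scalar_integral D g.
Proof.
move=> mD mN N0 [fr fi] [gr gi] fg.
have ae (h : scalars R k -> R) :
    ae_eq mu D (EFin \o (h \o f)) (EFin \o (h \o g)).
  exists (N `&` D); split => //; first exact: measurableI.
  by move=> x /= /not_implyP[Dx nfg]; split => //; apply: fg => // fgx;
    apply: nfg; rewrite fgx.
rewrite /scalar_integral /Rintegral; congr (scalar_mk _ (fine _) (fine _)).
- apply: ae_eq_integral; [by []|exact/measurable_EFinP..|].
  exact: (ae (@scalar_re R k)).
- apply: ae_eq_integral; [by []|exact/measurable_EFinP..|].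
  exact: (ae (@scalar_im R k)).
Qed.

Lemma scalar_integral_linear D s f g : measurable D ->
  scalar_integrable D f -> scalar_integrable D g ->
  scalar_integral D (fun x => s * f x + g x) =
  s * scalar_integral D f + scalar_integral D g.
Proof.
move=> mD [fr fi] [gr gi].
apply: scalar_eqP.
  rewrite scalar_reD scalar_reM !(scalar_re_integral, scalar_im_integral).
  under eq_Rintegral do rewrite scalar_reD scalar_reM.
  rewrite RintegralD//; last by apply: integrable_sub => //; exact: integrable_scale.
  by rewrite RintegralB ?RintegralZl//; exact: integrable_scale.
rewrite scalar_imD scalar_imM !(scalar_re_integral, scalar_im_integral).
under eq_Rintegral do rewrite scalar_imD scalar_imM.
rewrite RintegralD//; last by apply: integrable_add => //; exact: integrable_scale.
by rewrite RintegralD ?RintegralZl//; exact: integrable_scale.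
Qed.

(* With z the integral of f, |z|^2 is the integral of Re z Re f + Im z Im f,
   which Cauchy-Schwarz in R^2 bounds by |z| |f|. *)
Lemma scalar_abs_integral D f : measurable D -> scalar_measurable D f ->
  ((scalar_abs (scalar_integral D f))%:E <=
   \int[mu]_(t in D) (scalar_abs (f t))%:E)%E.
Proof.
move=> mD mf.
have [foo|] := ltP (\int[mu]_(t in D) (scalar_abs (f t))%:E)%E +oo%E;
  last by rewrite leye_eq => /eqP ->; rewrite leey.
have [fr fi] := scalar_integrableP mD mf foo.
set z := scalar_integral D f; set w := (\int[mu]_(t in D) scalar_abs (f t))%R.
have ia : mu.-integrable D (fun t => (scalar_abs (f t))%:E).
  apply/integrableP; split.
    by apply/measurable_EFinP; exact: scalar_measurable_abs.
  by under eq_integral do rewrite gee0_abs ?lee_fin ?scalar_abs_ge0//.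
rewrite -[leRHS]fineK ?integrable_fin_num// lee_fin -/w.
have w0 : 0 <= w by apply: Rintegral_ge0 => x _; exact: scalar_abs_ge0.
have zE : scalar_abs z ^+ 2 = (\int[mu]_(t in D)
    (scalar_re z * scalar_re (f t) + scalar_im z * scalar_im (f t)))%R.
  rewrite RintegralD//; [|exact: integrable_scale..].
  rewrite !RintegralZl// -scalar_re_integral -scalar_im_integral -/z -!expr2.
  by rewrite scalar_absE sqr_sqrtr// addr_ge0 ?sqr_ge0.
have : scalar_abs z ^+ 2 <= scalar_abs z * w.
  rewrite zE -RintegralZl//; apply: le_Rintegral => //.
  - by apply: integrable_add => //; exact: integrable_scale.
  - exact: integrable_scale.
  move=> x _; rewrite /= !scalar_absE -sqrtrM ?addr_ge0 ?sqr_ge0//.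
  apply: (le_trans (ler_norm _)); rewrite -sqrtr_sqr ler_wsqrtr//.
  have := sqr_ge0 (scalar_re z * scalar_im (f x) - scalar_im z * scalar_re (f x)).
  nra.
have [->|z0] := eqVneq (scalar_abs z) 0; first by [].
by rewrite expr2 ler_pM2l// lt_neqAle eq_sym z0 scalar_abs_ge0.
Qed.
End scalars.

(** * Weighted Hoelder inequality and dual mass *)

Section hoelder_weight.
Context (R : realType).
Notation mu := (@lebesgue_measure R).
Implicit Types (D A I N : set R) (h w : R -> R) (v : R -> \bar R).

Lemma le_poweR (x y : \bar R) (r : R) : 0 <= r -> (0 <= x)%E -> (x <= y)%E ->
  (x `^ r <= y `^ r)%E.
Proof.
move=> r0 x0 xy; apply: gt0_ler_poweR => //; rewrite in_itv/= leey andbT//.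
exact: le_trans xy.
Qed.

(** Serves to cut out the null set where a weight fails to be positive and finite, and to drop
    endpoints at which open and half-open intervals disagree. *)
Lemma integral_setD_null D N (f : R -> \bar R) : measurable D -> measurable N ->
  mu N = 0%E -> measurable_fun D f ->
  (\int[mu]_(x in D) f x = \int[mu]_(x in D `\` N) f x)%E.
Proof.
move=> mD mN N0 mf.
have mDN : measurable (D `\` N) by exact: measurableD.
rewrite -(setIidr (@subDsetl _ D N)) integral_mkcondr.
apply: ae_eq_integral => //.
  apply/measurable_restrict => //; apply: (measurable_funS mD) mf.
  by move=> x [].
exists N; split => // x /= /not_implyP[Dx]; rewrite patchE.
by case: ifPn => // /negP xN _; apply: contrapT => nN; apply: xN; rewrite inE.
Qed.

(** Hoelder's inequality for the factors h w^(1/p) and w^(-1/p), both extended by zero off A. The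
    p-th power of the first is h^p w; the p'-th power of the second is w^(-p'/p) = w^(1-p'). *)
Lemma hoelder_posweight A (p p' : R) w h : measurable A ->
  measurable_fun A w -> measurable_fun A h -> (forall x, A x -> 0 < w x) ->
  (forall x, A x -> 0 <= h x) -> 1 < p -> 1 < p' -> p^-1 + p'^-1 = 1 ->
  (\int[mu]_(x in A) (h x)%:E <=
   (\int[mu]_(x in A) (h x `^ p * w x)%:E) `^ p^-1 *
   (\int[mu]_(x in A) (w x `^ (1 - p'))%:E) `^ p'^-1)%E.
Proof.
move=> mA mw mh w0 h0 p1 p1' pp'.
have p0 : 0 < p by exact: lt_trans p1.
have p0' : 0 < p' by exact: lt_trans p1'.
pose F : R -> R := (fun x => h x * w x `^ p^-1) \_ A.
pose G : R -> R := (fun x => w x `^ (- p^-1)) \_ A.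
have mF : measurable_fun setT F.
  apply/(measurable_restrictT (fun x => h x * w x `^ p^-1) mA).
  by apply: measurable_funM => //; exact: (measurableT_comp (measurable_powR _)).
have mG : measurable_fun setT G.
  apply/(measurable_restrictT (fun x => w x `^ (- p^-1)) mA).
  exact: (measurableT_comp (measurable_powR _)).
have := hoelder mu mF mG p0 p0' pp'.
rewrite Lnorm1 unlock /=.
rewrite (_ : (\int[mu]_x _)%E = (\int[mu]_(x in A) (h x)%:E)%E); last first.
  rewrite [RHS]integral_mkcond; apply: eq_integral => x _ /=.
  rewrite /F /G !patchE; case: ifPn => [/set_mem xA|_]; last by rewrite mulr0 normr0.
  (* The two exponents of w add up to 0, and then [powRD] asks for a nonzero base: positivity of w
     enters here. *)
  rewrite -mulrA -powRD; last first.
    by apply/implyP => _; rewrite gt_eqF// w0.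
  by rewrite subrr powRr0 mulr1 ger0_norm ?h0.
rewrite (_ : (\int[mu]_x (`|F x| `^ p)%:E)%E =
             (\int[mu]_(x in A) (h x `^ p * w x)%:E)%E); last first.
  rewrite [RHS]integral_mkcond; apply: eq_integral => x _ /=.
  rewrite /F !patchE; case: ifPn => [/set_mem xA|_]; last first.
    by rewrite normr0 powR0// gt_eqF.
  rewrite ger0_norm ?mulr_ge0 ?powR_ge0 ?h0// powRM ?powR_ge0 ?h0//.
  by rewrite -powRrM mulVf ?gt_eqF// powRr1 ?ltW ?w0.
rewrite (_ : (\int[mu]_x (`|G x| `^ p')%:E)%E =
             (\int[mu]_(x in A) (w x `^ (1 - p'))%:E)%E); first exact.
rewrite [RHS]integral_mkcond; apply: eq_integral => x _ /=.
rewrite /G !patchE; case: ifPn => [/set_mem xA|_]; last first.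
  by rewrite normr0 powR0// gt_eqF.
rewrite ger0_norm ?powR_ge0// -powRrM; congr (_ `^ _)%:E.
have -> : p^-1 = 1 - p'^-1 by rewrite -pp' addrK.
by rewrite opprB mulrBl mulVf ?gt_eqF// mul1r.
Qed.

(** Since 0 < 1/p < 1, the relation forces 1/p' into ]0, 1[. This also rules out p' = 0, for which
    1/p' would be 0 by convention. *)
Lemma conjugate_gt1 (p p' : R) : 1 < p -> 1 / p + 1 / p' = 1 ->
  1 < p' /\ p^-1 + p'^-1 = 1.
Proof.
move=> p1; rewrite !div1r => pp'; split => //.
have p0 : 0 < p by exact: lt_trans p1.
have pV : p^-1 < 1 by rewrite invf_lt1.
have p'V : 0 < p'^-1 by lra.
have p'0 : 0 < p' by rewrite -invr_gt0.
have pV0 : 0 < p^-1 by rewrite invr_gt0.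
by rewrite ltNge; apply/negP; rewrite -invf_ge1// => p'V1; lra.
Qed.

(** * Weights that are positive and finite almost everywhere *)

Context (I : set R) (p p' : R) (v : R -> \bar R).
Hypotheses (mI : measurable I) (p1 : 1 < p) (pp' : 1 / p + 1 / p' = 1).
Hypotheses (mv : measurable_fun I v)
  (v_pos : {ae mu, forall x, I x -> (0 < v x < +oo)%E}).

Lemma measurable_dual_weight : measurable_fun I (fun x => v x `^ (1 - p'))%E.
Proof. exact: (measurableT_comp (measurable_poweR _)). Qed.

Lemma measurable_powR_weight h : measurable_fun I h ->
  measurable_fun I (fun x => ((h x `^ p)%:E * v x)%E).
Proof.
move=> mh; apply: emeasurable_funM => //; apply/measurable_EFinP.
exact: (measurableT_comp (measurable_powR _)).
Qed.

(** The norm is taken over all of I but the dual mass over D only; this is what makes increments of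
    Hf small over short intervals. Off the null set N the weight is a positive real function, so
    [hoelder_posweight] applies on D minus N. *)
Lemma hoelder_weight D h : measurable D -> D `<=` I ->
  measurable_fun I h -> (forall x, I x -> 0 <= h x) ->
  (\int[mu]_(x in D) (h x)%:E <=
   (\int[mu]_(x in I) ((h x `^ p)%:E * v x)) `^ p^-1 *
   dual_mass p' v D `^ p'^-1)%E.
Proof.
move=> mD DI mh h0.
have [p'1 pp] := conjugate_gt1 p1 pp'.
have [N [mN N0 vN]] := v_pos.
have v0 x : I x -> ~ N x -> (0 < v x < +oo)%E.
  move=> Ix Nx; apply: contrapT => vx; apply: Nx; apply: vN => /= H.
  by apply: vx; exact: H.
have vE x : I x -> ~ N x -> v x = (fine (v x))%:E.
  by move=> Ix Nx; have /andP[? ?] := v0 _ Ix Nx; rewrite fineK// gt0_fin_numE.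
have mDN : measurable (D `\` N) by exact: measurableD.
have mIN : measurable (I `\` N) by exact: measurableD.
have DNI : D `\` N `<=` I by move=> x [/DI].
rewrite /dual_mass (integral_setD_null mD mN N0); last first.
  by apply/measurable_EFinP; exact: measurable_funS mh.
rewrite [in leRHS](integral_setD_null mD mN N0); last first.
  exact: measurable_funS measurable_dual_weight.
have w0 x : (D `\` N) x -> 0 < fine (v x).
  by case=> /DI Ix Nx; rewrite fine_gt0// v0.
have mw : measurable_fun (D `\` N) (fun x => fine (v x)).
  apply: (measurableT_comp (fine_measurable measurableT)).
  exact: measurable_funS mv.
have := hoelder_posweight mDN mw (measurable_funS mI DNI mh) w0
  (fun x Dx => h0 x (DNI x Dx)) p1 p'1 pp.
move/le_trans; apply.
rewrite (_ : (\int[mu]_(x in D `\` N) (fine (v x) `^ (1 - p'))%:E)%E =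
             (\int[mu]_(x in D `\` N) (v x `^ (1 - p')))%E); last first.
  apply: eq_integral => x /set_mem[/DI Ix Nx].
  by rewrite [in RHS]vE.
apply: lee_wpmul2r; first exact: poweR_ge0.
apply: le_poweR; first by rewrite invr_ge0 ltW// (lt_trans _ p1).
  by apply: integral_ge0 => x Dx; rewrite lee_fin mulr_ge0 ?powR_ge0// ltW// w0.
(* On N the weight may be negative, so N is removed from I too before the domain is enlarged from D
   minus N to I minus N. *)
rewrite [leRHS](integral_setD_null mI mN N0); last exact: measurable_powR_weight.
rewrite (_ : (\int[mu]_(x in D `\` N) _)%E =
    (\int[mu]_(x in D `\` N) ((h x `^ p)%:E * v x))%E); last first.
  apply: eq_integral => x /set_mem[/DI Ix Nx].
  by rewrite [in RHS]vE.
apply: ge0_subset_integral => //.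
- apply: (measurable_funS mI); first by move=> ? [].
  exact: measurable_powR_weight.
- move=> x [Ix Nx]; rewrite mule_ge0 ?lee_fin ?powR_ge0//.
  by have /andP[/ltW] := v0 _ Ix Nx.
- by apply: setSD.
Qed.

(** [wLp_eq] measures its exceptional sets by v dx, whereas [hardy] integrates against Lebesgue
    measure. If v integrates to 0 over a set, v vanishes almost everywhere on it; as v is positive
    almost everywhere, the set is Lebesgue null. *)
Lemma weight_null N : measurable N -> (\int[mu]_(x in N `&` I) v x = 0)%E ->
  mu (N `&` I) = 0%E.
Proof.
move=> mN; have [M [mM M0 vM]] := v_pos.
have mNI : measurable (N `&` I) by exact: measurableI.
have v0 x : I x -> ~ M x -> (0 < v x < +oo)%E.
  move=> Ix Nx; apply: contrapT => vx; apply: Nx; apply: vM => /= H.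
  by apply: vx; exact: H.
have mvNI : measurable_fun (N `&` I) v by exact: measurable_funS mv.
rewrite (integral_setD_null mNI mM M0)// => v00.
have mNIM : measurable ((N `&` I) `\` M) by exact: measurableD.
have mvNIM : measurable_fun ((N `&` I) `\` M) v.
  by apply: measurable_funS mvNI => // x [].
have /(ae_eq_integral_abs mu mNIM mvNIM)[Z [mZ Z0 vZ]] :
    (\int[mu]_(x in (N `&` I) `\` M) `|v x| = 0)%E.
  rewrite -[RHS]v00; apply: eq_integral => x /set_mem[[_ Ix] Mx].
  by rewrite gee0_abs//; have /andP[/ltW] := v0 _ Ix Mx.
apply/eqP; rewrite eq_le measure_ge0 andbT.
rewrite (@le_trans _ _ (mu (Z `|` M)))//.
  apply: le_measure; rewrite ?inE//; first exact: measurableU.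
  move=> x [Nx Ix]; have [|Mx] := pselect (M x); [by right|left].
  apply: vZ => /= H; have := v0 _ Ix Mx; rewrite H//.
  by rewrite ltxx.
apply: (le_trans (measureU2 _ mZ mM)).
by move: Z0 M0 => /= -> ->; rewrite adde0.
Qed.

Lemma dual_mass_ge0 D : (0 <= dual_mass p' v D)%E.
Proof. by apply: integral_ge0 => x _; exact: poweR_ge0. Qed.

Lemma le_dual_mass A D : measurable A -> measurable D -> D `<=` I -> A `<=` D ->
  (dual_mass p' v A <= dual_mass p' v D)%E.
Proof.
move=> mA mD DI AD; apply: ge0_subset_integral => //.
  exact: measurable_funS measurable_dual_weight.
by move=> x _; exact: poweR_ge0.
Qed.

(** Absolute continuity of the integral, the source of the convergence of the moduli to 0. Finite
    dual mass makes v^(1-p') finite almost everywhere on D; discarding the exceptional set and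
    extending by zero gives an integrable real function f on the line. *)
Lemma dual_mass_small D (e : R) : measurable D -> D `<=` I ->
  (dual_mass p' v D < +oo)%E -> 0 < e ->
  exists2 r : R, 0 < r & forall A, measurable A -> A `<=` D ->
    (mu A < r%:E)%E -> (dual_mass p' v A < e%:E)%E.
Proof.
move=> mD DI Doo e0.
have mw : measurable_fun D (fun x => v x `^ (1 - p'))%E.
  exact: measurable_funS measurable_dual_weight.
have [N [mN N0 wN]] : {ae mu, forall x, D x -> (v x `^ (1 - p'))%E \is a fin_num}.
  apply: integrable_ae => //; apply/integrableP; split => //.
  by under eq_integral do rewrite gee0_abs ?poweR_ge0//.
have wE x : D x -> ~ N x -> (v x `^ (1 - p') = (fine (v x `^ (1 - p')))%:E)%E.
  move=> Dx Nx; rewrite fineK//; apply: contrapT => vx; apply: Nx; apply: wN.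
  by move=> /= H; apply: vx; exact: H.
have mDN : measurable (D `\` N) by exact: measurableD.
pose f : R -> R := (fun x => fine (v x `^ (1 - p'))%E) \_ (D `\` N).
have fi : mu.-integrable setT (EFin \o f).
  rewrite -restrict_EFin; apply/integrable_restrict => //; rewrite setTI.
  have iN : mu.-integrable (D `\` N) (fun x => v x `^ (1 - p'))%E.
    have iD : mu.-integrable D (fun x => v x `^ (1 - p'))%E.
      apply/integrableP; split => //.
      by under eq_integral do rewrite gee0_abs ?poweR_ge0//.
    by apply: integrableS iD => //; exact: subDsetl.
  by apply: eq_integrable iN => // x /set_mem[Dx Nx] /=; rewrite -wE.
have [r [r0 fr]] := integral_normr_continuous fi e0.
exists r => // A mA AD /(fr A mA) Ae.
rewrite /dual_mass (integral_setD_null mA mN N0); last exact: measurable_funS mw.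
rewrite (_ : (\int[mu]_(x in A `\` N) _)%E = (\int[mu]_(x in A) `|(f x)%:E|)%E).
  rewrite -(@fineK _ (\int[mu]_(x in A) _)%E) ?lte_fin//.
  rewrite ge0_fin_numE ?integral_ge0//.
  have [_] := integrableP _ _ _ fi; apply: le_lt_trans.
  apply: ge0_subset_integral => //.
  by apply: measurableT_comp => //; have [] := integrableP _ _ _ fi.
rewrite -(setIidr (@subDsetl _ A N)) integral_mkcondr.
apply: eq_integral => x /set_mem Ax.
rewrite /f !patchE; have [Nx|Nx] := pselect (N x).
  rewrite !ifF ?abse0//; apply/negP => /set_mem[]//.
rewrite !ifT ?inE//; last by split => //; exact: AD.
by rewrite wE//; [rewrite /= ger0_norm// fine_ge0// poweR_ge0|exact: AD].
Qed.
End hoelder_weight.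

(** * The Hardy operator *)

Section hardy_operator.
Context (R : realType) (k : scalar_kind).
Notation mu := (@lebesgue_measure R).
Implicit Types (f g : R -> scalars R k).

Lemma measurable_eitv (a b : \bar R) : measurable (eitv a b).
Proof.
rewrite (_ : eitv a b = setT `&` EFin @^-1` [set` `]a, b[]); last first.
  by apply/seteqP; split => x; rewrite /eitv /= in_itv//= => -[].
by apply: EFin_measurable => //; exact: emeasurable_itv.
Qed.

Lemma sub_eitv (a b b' : \bar R) : (b <= b')%E -> eitv a b `<=` eitv a b'.
Proof. by move=> bb x /andP[ax xb]; rewrite /eitv/= ax (lt_le_trans xb). Qed.

Lemma itv_sub_eitv (a b : \bar R) (y x : R) : (a < y%:E)%E -> (x%:E < b)%E ->
  `[y, x]%classic `<=` eitv a b.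
Proof.
move=> ay xb z; rewrite /= in_itv/= => /andP[yz zx]; apply/andP; split.
  by apply: (lt_le_trans ay); rewrite lee_fin.
by apply: le_lt_trans xb; rewrite lee_fin.
Qed.

Lemma eitv_split (a : \bar R) (y x : R) : (a < y%:E)%E -> y <= x ->
  eitv a x%:E = eitv a y%:E `|` `[y, x[%classic.
Proof.
move=> ay yx; apply/seteqP; split => z.
  move=> /andP[az zx]; have [zy|yz] := ltP z y.
    by left; apply/andP; rewrite lte_fin.
  by right; rewrite /= in_itv/= yz -lte_fin.
case=> [/andP[az zy]|].
  by apply/andP; split => //; apply: (lt_le_trans zy); rewrite lee_fin.
rewrite /= in_itv/= => /andP[yz zx]; apply/andP; split; last by rewrite lte_fin.
by apply: (lt_le_trans ay); rewrite lee_fin.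
Qed.

(** The increment is put over the open interval, dropping the null point y, to match the intervals
    in [modulus]. *)
Lemma hardy_split (a : \bar R) f (y x : R) : (a < y%:E)%E -> y <= x ->
  scalar_integrable (eitv a x%:E) f ->
  hardy a f x = hardy a f y + scalar_integral `]y, x[%classic f.
Proof.
move=> ay yx [fr fi].
have dis : [disjoint eitv a y%:E & `[y, x[%classic].
  apply/disj_set2P/seteqP; split => // z [/andP[_ zy]] /=.
  by rewrite in_itv/= => /andP[yz _]; rewrite lte_fin ltNge yz in zy.
have mI z := measurable_eitv a z.
have E (h : R -> R) : mu.-integrable (eitv a x%:E) (EFin \o h) ->
    (\int[mu]_(t in eitv a x%:E) h t = \int[mu]_(t in eitv a y%:E) h t +
     \int[mu]_(t in `]y, x[) h t)%R.
  move=> ih; rewrite (eitv_split ay yx) Rintegral_setU//; [|exact: mI|]; last first.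
    by rewrite -(eitv_split ay yx).
  congr (_ + _); rewrite -Rintegral_itv_obnd_cbnd//.
  apply: integrableS ih => //; first exact: mI.
  rewrite (eitv_split ay yx) => z zyx; right.
  by move: zyx; rewrite /= !in_itv/= => /andP[/ltW -> ->].
by apply: scalar_eqP; rewrite ?scalar_reD ?scalar_imD
  !(scalar_re_integral, scalar_im_integral) E.
Qed.

Context (a b : \bar R) (p p' : R) (v : R -> \bar R).
Notation I := (eitv a b).
Notation X := (WLp I p v).
Hypotheses (p1 : 1 < p) (pp' : 1 / p + 1 / p' = 1).
Hypotheses (mv : measurable_fun I v)
  (v_pos : {ae mu, forall x, I x -> (0 < v x < +oo)%E})
  (V_fin : forall x : R, I x -> (Vfun a p' v x < +oo)%E).

Let mI : measurable I := measurable_eitv a b.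

Lemma wLp_norm_ge0 (Z : wLp R) f : (0 <= wLp_norm Z f)%E.
Proof. exact: poweR_ge0. Qed.

Lemma integral_abs_le D f : measurable D -> D `<=` I -> in_wLp X f ->
  (\int[mu]_(t in D) (scalar_abs (f t))%:E <=
   wLp_norm X f * dual_mass p' v D `^ p'^-1)%E.
Proof.
move=> mD DI [mf _]; apply: hoelder_weight => //.
  exact: scalar_measurable_abs.
by move=> x _; exact: scalar_abs_ge0.
Qed.

Lemma in_wLp_integrable D f : measurable D -> D `<=` I -> in_wLp X f ->
  (dual_mass p' v D < +oo)%E -> scalar_integrable D f.
Proof.
move=> mD DI Xf Doo; have [[fr fi] foo] := Xf.
apply: scalar_integrableP => //.
  by split; [exact: measurable_funS fr|exact: measurable_funS fi].
apply: (le_lt_trans (integral_abs_le mD DI Xf)).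
by rewrite lte_mul_pinfty ?wLp_norm_ge0 ?poweR_lty// ge0_fin_numE ?wLp_norm_ge0.
Qed.

Lemma scalar_abs_integral_le D f : measurable D -> D `<=` I -> in_wLp X f ->
  ((scalar_abs (scalar_integral D f))%:E <=
   wLp_norm X f * dual_mass p' v D `^ p'^-1)%E.
Proof.
move=> mD DI Xf; apply: le_trans (integral_abs_le mD DI Xf).
apply: scalar_abs_integral => //; have [[fr fi] _] := Xf.
by split; [exact: measurable_funS fr|exact: measurable_funS fi].
Qed.

Lemma eitv_subI x : I x -> eitv a x%:E `<=` I.
Proof. by move=> /andP[_ /ltW xb]; exact: sub_eitv. Qed.

Lemma hardy_integrable f x : in_wLp X f -> I x ->
  scalar_integrable (eitv a x%:E) f.
Proof.
move=> Xf Ix; apply: in_wLp_integrable => //.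
- exact: measurable_eitv.
- exact: eitv_subI.
- exact: V_fin.
Qed.

Lemma hardy_le f x : in_wLp X f -> I x ->
  ((scalar_abs (hardy a f x))%:E <= wLp_norm X f * Vfun a p' v x `^ p'^-1)%E.
Proof.
move=> Xf Ix; apply: scalar_abs_integral_le => //.
  exact: measurable_eitv.
exact: eitv_subI.
Qed.

Lemma hardy_diff_le f y x : in_wLp X f -> I y -> I x -> y <= x ->
  ((scalar_abs (hardy a f x - hardy a f y))%:E <=
   wLp_norm X f * dual_mass p' v `]y, x[%classic `^ p'^-1)%E.
Proof.
move=> Xf /andP[ay _] Ix yx; rewrite (hardy_split ay yx); last exact: hardy_integrable.
rewrite addrAC subrr add0r; apply: scalar_abs_integral_le => //.
move=> z zyx; apply: (itv_sub_eitv ay (proj2 (andP Ix))).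
by move: zyx; rewrite /= !in_itv/= => /andP[/ltW -> /ltW ->].
Qed.

Lemma hardy_linear s f g x : in_wLp X f -> in_wLp X g -> I x ->
  hardy a (fun t => s * f t + g t) x = s * hardy a f x + hardy a g x.
Proof.
move=> Xf Xg Ix; apply: scalar_integral_linear; first exact: measurable_eitv.
  exact: hardy_integrable.
exact: hardy_integrable.
Qed.

Lemma hardy_wLp_eq f g x : in_wLp X f -> in_wLp X g -> wLp_eq X f g -> I x ->
  hardy a f x = hardy a g x.
Proof.
move=> [[fr fi] _] [[gr gi] _] [N [mN N0 fg]] Ix.
have xI := eitv_subI Ix.
have NI0 : mu (N `&` I) = 0%E by exact: weight_null N0.
apply: (@eq_scalar_integral_ae _ _ _ _ _ (N `&` I)).
- exact: measurable_eitv.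
- exact: measurableI.
- by rewrite -setIA (setIidr xI); apply: subset_measure0 NI0;
   [apply: measurableI => //; exact: measurable_eitv|exact: measurableI|exact: setIS].
- by split; [exact: measurable_funS fr|exact: measurable_funS fi].
- by split; [exact: measurable_funS gr|exact: measurable_funS gi].
- by move=> t /xI It ft; split => //; exact: fg.
Qed.

(** Each part of Hf is, on [c, d], a constant plus the integral from c to x of an integrable
    function, hence continuous there. *)
Lemma hardy_measurable f (c d : R) : in_wLp X f -> I c -> I d -> c <= d ->
  scalar_measurable `]c, d[%classic (hardy a f).
Proof.
move=> Xf Ic Id cd; have /andP[ac _] := Ic; have /andP[_ db] := Id.
have cdI : `[c, d]%classic `<=` I by exact: itv_sub_eitv.
have icd : scalar_integrable `[c, d]%classic f.
  (* V(d) is an integral over ]a, d[, so the null point d is removed from [c, d] before the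
     comparison. *)
  apply: in_wLp_integrable => //; apply: le_lt_trans (V_fin Id).
  rewrite /dual_mass (@integral_setD_null _ _ [set d])//; last 2 first.
  - by rewrite lebesgue_measure_set1.
  - exact: measurable_funS (measurable_dual_weight _ mv).
  rewrite -[leLHS]/(dual_mass p' v _); apply: (le_dual_mass p' mI mv).
  - by apply: measurableD.
  - exact: measurable_eitv.
  - exact: eitv_subI.
  move=> x [/=]; rewrite in_itv/= => /andP[cx xd] /eqP xnd; apply/andP; split.
    by apply: (lt_le_trans ac); rewrite lee_fin.
  by rewrite lte_fin lt_neqAle xnd.
have key (h : R -> R) (r : scalars R k -> R) :
    mu.-integrable `[c, d] (EFin \o h) ->
    (forall x, c <= x <= d -> r (hardy a f x) =
      r (hardy a f c) + \int[mu]_(t in `]c, x[) h t)%R ->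
    measurable_fun `]c, d[%classic (fun x => r (hardy a f x)).
  move=> ih hE.
  apply: (@measurable_funS _ _ _ _ `[c, d]%classic) => //.
    by apply: subset_itvW.
  apply: (eq_measurable_fun (fun x => r (hardy a f c) +
      parameterized_integral mu c x h)).
    move=> x; rewrite inE/= in_itv/= => /andP[cx xd].
    rewrite (hE x) ?cx//; congr (_ + fine _); apply: integral_itv_bndoo.
    apply: (measurable_funS _ _ (measurable_int _ ih)) => // z /=.
    by rewrite !in_itv/= => /andP[/ltW -> /ltW zx]; exact: le_trans xd.
  apply: measurable_funD => //; apply: subspace_continuous_measurable_fun => //.
  exact: parameterized_integral_continuous.
have xE x : c <= x <= d -> hardy a f x = hardy a f c +
    scalar_integral `]c, x[%classic f.
  move=> /andP[cx xd]; apply: hardy_split => //; apply: hardy_integrable => //.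
  by apply: cdI; rewrite /= in_itv/= cx.
split.
  apply: (key (fun t => scalar_re (f t))); first by case: icd.
  by move=> x /xE ->; rewrite scalar_reD scalar_re_integral.
apply: (key (fun t => scalar_im (f t))); first by case: icd.
by move=> x /xE ->; rewrite scalar_imD scalar_im_integral.
Qed.

(** * Bounds and moduli on [c, d] *)

Context (c d : R).
Hypotheses (Ic : I c) (Id : I d) (cd : c <= d).

Lemma itv_subI x : c <= x <= d -> I x.
Proof.
have /andP[ac _] := Ic; have /andP[_ db] := Id.
by move=> xcd; apply: (itv_sub_eitv ac db); rewrite /= in_itv/=.
Qed.

Let p'V_ge0 : 0 <= p'^-1.
Proof. by rewrite invr_ge0 ltW// (lt_trans ltr01)//; have [] := conjugate_gt1 p1 pp'. Qed.

Lemma hardy_le_right f x : in_wLp X f -> c <= x <= d ->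
  ((scalar_abs (hardy a f x))%:E <= wLp_norm X f * Vfun a p' v d `^ p'^-1)%E.
Proof.
move=> Xf cxd; apply: (le_trans (hardy_le Xf (itv_subI cxd))).
apply: lee_wpmul2l; first exact: wLp_norm_ge0.
apply: le_poweR => //; first exact: dual_mass_ge0.
apply: (le_dual_mass p' mI mv).
- exact: measurable_eitv.
- exact: measurable_eitv.
- exact: eitv_subI.
- by apply: sub_eitv; rewrite lee_fin; case/andP: cxd.
Qed.

Lemma Vfun_poweR_lty : (Vfun a p' v d `^ p'^-1 < +oo)%E.
Proof. by rewrite poweR_lty// V_fin. Qed.

Lemma le_modulus r r' : r <= r' ->
  (modulus p' v c d r <= modulus p' v c d r')%E.
Proof.
move=> rr; apply: le_ereal_sup => z [x [y [cx xy yd yx ->]]].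
by exists x, y; split => //; exact: le_trans rr.
Qed.

(** For r < 0 no pair is admissible and the supremum is -oo; for r >= 0 the pair x = y = c is always
    available. *)
Lemma modulus_ge0 r : 0 <= r -> (0 <= modulus p' v c d r)%E.
Proof.
move=> r0.
apply: (@le_trans _ _ (dual_mass p' v `]c, c[%classic `^ p'^-1)%E).
  exact: poweR_ge0.
by apply: ereal_sup_ubound; exists c, c; split => //; rewrite subrr.
Qed.

Let itv_sub_right x y : c <= x -> y <= d -> `]x, y[%classic `<=` eitv a d%:E.
Proof.
move=> cx yd z; rewrite /= in_itv/= => /andP[xz zy]; apply/andP; split.
  by have /andP[ac _] := Ic; apply: (lt_trans ac); rewrite lte_fin (le_lt_trans cx).
by rewrite lte_fin (lt_le_trans zy).
Qed.

Lemma modulus_lty r : (modulus p' v c d r < +oo)%E.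
Proof.
apply: le_lt_trans Vfun_poweR_lty; apply: ub_ereal_sup => z [x [y [cx xy yd _ ->]]].
apply: le_poweR => //; first exact: dual_mass_ge0.
apply: (le_dual_mass p' mI mv) => //.
- exact: measurable_eitv.
- exact: eitv_subI.
- exact: itv_sub_right.
Qed.

Lemma modulus_small (e : R) : 0 < e ->
  exists2 r, 0 < r & (modulus p' v c d r <= e%:E)%E.
Proof.
move=> e0; have [p'1 _] := conjugate_gt1 p1 pp'.
have p'0 : 0 < p' by exact: lt_trans p'1.
(* The modulus is a root of order p' of a dual mass, so the dual mass itself has to fall below
   e^p'. *)
have ep0 : 0 < e `^ p' by exact: powR_gt0.
have mJ : measurable (eitv a d%:E) by exact: measurable_eitv.
have [r r0 rE] := dual_mass_small mI mv mJ (eitv_subI Id) (V_fin Id) ep0.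
(* [dual_mass_small] wants measure strictly below r, while the modulus admits y - x equal to its
   argument; halving r gives the strict inequality. *)
exists (r / 2); first by rewrite divr_gt0.
apply: ub_ereal_sup => z [x [y [cx xy yd yx ->]]].
have -> : e%:E = ((e `^ p')%:E `^ p'^-1)%E.
  by rewrite poweR_EFin -powRrM mulfV ?gt_eqF// powRr1// ltW.
apply: le_poweR => //; first exact: dual_mass_ge0.
apply/ltW/rE => //; first exact: itv_sub_right.
apply: (@le_lt_trans _ _ (y - x)%:E).
  rewrite lebesgue_measure_itv/=; case: ifPn => // _.
  by rewrite lee_fin subr_ge0.
by rewrite lte_fin (le_lt_trans yx)// ltr_pdivrMr// ltr_pMr// ltr1n.
Qed.

Lemma hardy_diff_modulus f y x r : in_wLp X f -> c <= y -> y <= x -> x <= d ->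
  x - y <= r ->
  ((scalar_abs (hardy a f x - hardy a f y))%:E <=
   wLp_norm X f * modulus p' v c d r)%E.
Proof.
move=> Xf cy yx xd xyr.
have Iy : I y by apply: itv_subI; rewrite cy (le_trans yx).
have Ix : I x by apply: itv_subI; rewrite xd (le_trans cy).
apply: (le_trans (hardy_diff_le Xf Iy Ix yx)).
apply: lee_wpmul2l; first exact: wLp_norm_ge0.
by apply: ereal_sup_ubound; exists y, x.
Qed.

End hardy_operator.

(** * Rank *)

Section rank.
Context (R : realType) (k : scalar_kind).
Implicit Types (X Y : wLp R) (f g h : R -> scalars R k).

Lemma wLp_eq_eqfun X f g : (forall x, wLp_dom X x -> f x = g x) -> wLp_eq X f g.
Proof.
move=> fg; exists set0; split => //; first by rewrite set0I integral_set0.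
by move=> x /fg ->.
Qed.

Lemma exists_row_kernel (F : fieldType) (r m : nat) (A : 'M[F]_(r, m)) :
  (m < r)%N -> exists2 u : 'rV[F]_r, u != 0 & u *m A = 0.
Proof.
move=> mr; have : kermx A != 0.
  by rewrite kermx_eq0 /row_free neq_ltn (leq_ltn_trans (rank_leq_col A)).
by move=> /rowV0Pn[u /sub_kermxP uA u0]; exists u.
Qed.

(** The functions e_j may lie outside the span of the range and be dependent in Y, so no basis is
    extracted from them. Instead a family in the span, independent modulo equality in Y, is taken of
    maximal size: the e_j bound that size by m, and maximality makes the family generate. *)
Lemma has_rank_le (X1 X2 Y : wLp R)
    (T : (R -> scalars R k) -> (R -> scalars R k) -> R -> scalars R k)
    (m : nat) (e : 'I_m -> R -> scalars R k) :
  (forall h, range_span X1 X2 T h -> exists s : 'I_m -> scalars R k,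
     forall x, h x = \sum_(j < m) s j * e j x) ->
  exists2 r : nat, has_rank X1 X2 Y T r & (r <= m)%N.
Proof.
move=> Te.
pose free r (w : 'I_r -> R -> scalars R k) :=
  (forall i, range_span X1 X2 T (w i)) /\
  (forall s : 'I_r -> scalars R k,
     wLp_eq Y (fun x => \sum_(i < r) s i * w i x) (fun=> 0) -> forall i, s i = 0).
pose P r := `[< exists w, @free r w >].
have P0 : exists r, P r.
  by exists 0%N; apply/asboolP; exists (fun=> fun=> 0); split => [[]|s _ []].
have Pm r : P r -> (r <= m)%N.
  move=> /asboolP[w [Sw wI]]; rewrite leqNgt; apply/negP => mr.
  (* Row i of A holds the coordinates of w_i in the e_j. With more than m rows some nonzero row u
     has u A = 0, and its entries give a pointwise relation between the w_i. *)
  have [A AE] := choice (fun i => Te _ (Sw i)).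
  have [u /eqP u0 uA] := exists_row_kernel (\matrix_(i, j) A i j) mr.
  apply: u0; apply/rowP => i; rewrite mxE.
  apply: (wI (fun i => u 0 i)); apply: wLp_eq_eqfun => x _.
  under eq_bigr do rewrite AE mulr_sumr.
  rewrite exchange_big big1//= => j _.
  under eq_bigr do rewrite mulrA.
  rewrite -mulr_suml; have /rowP/(_ j) := uA.
  rewrite !mxE; under eq_bigr do rewrite mxE.
  by move=> ->; rewrite mul0r.
have [r Pr rmax] := ex_maxnP P0 Pm; exists r; last exact: Pm.
have /asboolP[w [Sw wI]] := Pr; exists w; split => // h Sh.
(* The family w with h placed at the last index; maximality of r makes it dependent. *)
pose w' (i : 'I_r.+1) := oapp w h (unlift ord_max i).
have : ~ free r.+1 w'.
  by move=> fw; have /rmax : P r.+1 by [apply/asboolP; exists w']; rewrite ltnn.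
move=> /not_andP[]; first by case=> i; rewrite /w'; case: unlift.
move=> /existsNP[s] /not_implyP[sw] /existsNP[i0] si0.
have sE x : \sum_(i < r.+1) s i * w' i x =
    s ord_max * h x + \sum_(i < r) s (lift ord_max i) * w i x.
  rewrite (bigD1_ord ord_max)//= /w' unlift_none; congr (_ + _).
  by apply: eq_bigr => i _; rewrite liftK.
(* If h has coefficient 0, the relation involves w alone and all its coefficients vanish,
   contradicting [si0]. Otherwise it is solved for h. *)
have [s0|s0] := eqVneq (s ord_max) 0.
  case: si0; have {}sw : wLp_eq Y
      (fun x => \sum_(i < r) s (lift ord_max i) * w i x) (fun=> 0).
    have [N [mN N0 fN]] := sw; exists N; split => // x Yx Nx; apply: fN => //.
    by rewrite sE s0 mul0r add0r.
  have [j|] := unliftP ord_max i0; last by move=> ->.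
  by move=> ->; exact: (wI (fun i => s (lift ord_max i))).
exists (fun i => - (s ord_max)^-1 * s (lift ord_max i)).
have [N [mN N0 fN]] := sw; exists N; split => // x Yx hx; apply: fN => // {}fN.
apply: hx; move: fN; rewrite sE => /eqP; rewrite addr_eq0 => /eqP sh.
rewrite -[h x](mulKf s0) sh mulrN mulr_sumr -sumrN.
by apply: eq_bigr => i _; rewrite mulNr mulrA mulNr.
Qed.
End rank.

(** * Partitions *)

Section partition.
Context (R : realType).
Implicit Types (c d x : R) (P : seq R).

Lemma le_node c d P i j : itv_partition c d P -> (i <= j <= size P)%N ->
  node c P i <= node c P j.
Proof.
move=> [cP _] /andP[ij jP].
have sP : sorted <%O (c :: P) by [].
by rewrite (lt_sorted_leq_nth c sP) ?inE//= ?ltnS// (leq_trans ij).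
Qed.

Lemma node_last c d P : itv_partition c d P -> node c P (size P) = d.
Proof. by move=> [_ /eqP <-]; rewrite /node -[last c P]/(last c (c :: P)) -nth_last. Qed.

Lemma node_bounds c d P j : itv_partition c d P -> (j <= size P)%N ->
  c <= node c P j <= d.
Proof.
move=> cdP jP; have := le_node cdP (i := 0) (j := j); rewrite jP => -> //.
by have := le_node cdP (i := j) (j := size P); rewrite jP leqnn (node_last cdP) => ->.
Qed.

Lemma node_exists c d P x : itv_partition c d P -> c <= x < d ->
  exists j : 'I_(size P), node c P j <= x < node c P j.+1.
Proof.
elim: P c => [|y P ih] c cdP /andP[cx xd].
  by have := itv_partition_nil cdP => E; move: cx; rewrite E leNgt xd.
have [xy|yx] := ltP x y; first by exists ord0; rewrite /node/= cx.
have [j jx] := ih _ (itv_partition_cons cdP) (introT andP (conj yx xd)).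
(* The default value of [nth] in [node] is the left endpoint, which the induction changes from c to
   y; hence [set_nth_default]. *)
exists (lift ord0 j); rewrite /node /= (set_nth_default y) ?ltnS//=; last first.
  exact: ltnW (ltn_ord j).
by rewrite add0n (set_nth_default y).
Qed.

Lemma node_unique c d P x (i j : 'I_(size P)) : itv_partition c d P ->
  node c P i <= x < node c P i.+1 -> node c P j <= x < node c P j.+1 -> i = j.
Proof.
move=> cdP /andP[ix xi] /andP[jx xj]; apply/val_inj/eqP; rewrite eqn_leq.
apply/andP; split; rewrite leqNgt; apply/negP => ij.
  have := le_node cdP (i := j.+1) (j := i); rewrite ij/= ltnW// => /(_ isT).
  by move=> /(lt_le_trans xj)/lt_le_trans/(_ ix); rewrite ltxx.
have := le_node cdP (i := i.+1) (j := j); rewrite ij/= ltnW// => /(_ isT).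
by move=> /(lt_le_trans xi)/lt_le_trans/(_ jx); rewrite ltxx.
Qed.

Lemma node_mesh c P (j : 'I_(size P)) :
  node c P j.+1 - node c P j <= mesh c P.
Proof. by apply: (le_bigmax _ (fun j : 'I_(size P) => node c P j.+1 - node c P j)). Qed.

Lemma mesh_ge0 c P : 0 <= mesh c P.
Proof. by rewrite /mesh; elim/big_rec : _ => // i x _ x0; rewrite le_max x0 orbT. Qed.

(** The factor [i.+1] starts the list at x_1, since the left endpoint c is not stored. *)
Definition uniform_partition c d (m : nat) : seq R :=
  [seq c + (d - c) / m%:R * i.+1%:R | i <- iota 0 m].

Lemma size_uniform_partition c d m : size (uniform_partition c d m) = m.
Proof. by rewrite size_map size_iota. Qed.

Lemma node_uniform_partition c d m j : (j <= m)%N ->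
  node c (uniform_partition c d m) j = c + (d - c) / m%:R * j%:R.
Proof.
case: j => [|j] jm; first by rewrite /node/= mulr0 addr0.
by rewrite /node/= (nth_map 0%N) ?size_iota// nth_iota.
Qed.

Lemma itv_partition_uniform c d m : c < d -> (0 < m)%N ->
  itv_partition c d (uniform_partition c d m).
Proof.
move=> cd m0; split.
  apply/(pathP c) => i; rewrite size_uniform_partition => im.
  rewrite -[ltLHS]/(node c (uniform_partition c d m) i).
  rewrite -[ltRHS]/(node c (uniform_partition c d m) i.+1).
  rewrite !node_uniform_partition//; last exact: ltnW.
  by rewrite ltrD2l ltr_pM2l ?ltr_nat// divr_gt0 ?subr_gt0// ltr0n.
rewrite -[last _ _]/(last c (c :: uniform_partition c d m)) -nth_last.
rewrite -[nth c _ _]/(node c (uniform_partition c d m) _)/=.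
rewrite size_uniform_partition node_uniform_partition//.
by rewrite divfK ?pnatr_eq0 -?lt0n// addrC subrK.
Qed.

(** An upper bound suffices, because the error estimate holds with any r above the mesh. *)
Lemma mesh_uniform_partition c d m : c < d -> (0 < m)%N ->
  mesh c (uniform_partition c d m) <= (d - c) / m%:R.
Proof.
move=> cd m0; apply: bigmax_le; first by rewrite divr_ge0// subr_ge0 ltW.
move=> i _; have im : (i < m)%N by rewrite -{2}(size_uniform_partition c d m).
rewrite !node_uniform_partition ?(ltnW im)//.
by rewrite opprD addrACA subrr add0r -mulrBr -natr1 addrAC subrr add0r mulr1.
Qed.

End partition.

(** * Approximation by step maps *)

Section step_approximation.
Context (R : realType) (k : scalar_kind) (a b : \bar R).
Context (p1 p2 p1' p2' q : R) (v1 v2 : R -> \bar R) (u : R -> R).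
Notation mu := (@lebesgue_measure R).
Notation I := (eitv a b).
Notation X1 := (WLp I p1 v1).
Notation X2 := (WLp I p2 v2).
Notation Y := (WLp I q (EFin \o u)).
Implicit Types (f g h : R -> scalars R k).
Hypotheses (p1_gt1 : 1 < p1) (p2_gt1 : 1 < p2) (q_gt0 : 0 < q).
Hypotheses (p1_conj : 1 / p1 + 1 / p1' = 1) (p2_conj : 1 / p2 + 1 / p2' = 1).
Hypotheses (v1_meas : measurable_fun I v1) (v2_meas : measurable_fun I v2).
Hypotheses (v1_pos : {ae mu, forall x : R, I x -> (0 < v1 x < +oo)%E})
  (v2_pos : {ae mu, forall x : R, I x -> (0 < v2 x < +oo)%E}).
Hypotheses (u_ge0 : forall x : R, I x -> 0 <= u x)
  (u_loc : locally_integrable I u).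
Hypotheses (V1_fin : forall x : R, I x -> (Vfun a p1' v1 x < +oo)%E)
  (V2_fin : forall x : R, I x -> (Vfun a p2' v2 x < +oo)%E).
Context (c d : R).
Hypotheses (ac : (a < c%:E)%E) (cd : c < d) (db : (d%:E < b)%E).
Local Notation H2cd := (@hardy2_on R k a `]c, d[%classic).
Local Notation osc := (oscillation a p1' p2' v1 v2 c d).

Let Ic : I c. Proof. by apply/andP; rewrite (lt_trans _ db) ?lte_fin. Qed.
Let Id : I d. Proof. by apply/andP; rewrite (lt_trans ac) ?lte_fin. Qed.
Let mI : measurable I := measurable_eitv a b.
Let u_meas : measurable_fun I u. Proof. by case: u_loc. Qed.
Let cdI : `]c, d[%classic `<=` I.
Proof.
move=> x; rewrite /= in_itv/= => /andP[cx xd].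
by apply: (itv_subI Ic Id); rewrite !ltW.
Qed.

(** * Norms in Y of functions living on [c, d] *)

Lemma Umass_ge0 : (0 <= Umass u c d)%E.
Proof. by apply: integral_ge0 => x /cdI Ix; rewrite lee_fin u_ge0. Qed.

(** As a < c and d < b, the closed interval [c, d] is a compact subset of I, where local
    integrability applies. *)
Lemma Umass_lty : (Umass u c d < +oo)%E.
Proof.
have [_ _ uK] := u_loc.
have cdI' : `[c, d]%classic `<=` I by exact: itv_sub_eitv.
apply: (le_lt_trans _ (uK _ cdI' (@segment_compact _ c d))).
apply: (@le_trans _ _ (\int[mu]_(x in `[c, d]) (u x)%:E)%E).
  apply: ge0_subset_integral => //.
  - by apply/measurable_EFinP; exact: measurable_funS u_meas.
  - by move=> x /cdI' Ix; rewrite lee_fin u_ge0.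
  - exact: subset_itvW.
apply: ge0_le_integral => //.
- by move=> x /cdI' Ix; rewrite lee_fin u_ge0.
- by apply/measurable_EFinP; exact: measurable_funS u_meas.
- by apply/measurable_EFinP; apply: measurableT_comp => //; exact: measurable_funS u_meas.
- by move=> x _; rewrite lee_fin ler_norm.
Qed.

Lemma measurable_wLp_integrand h : scalar_measurable I h ->
  measurable_fun I (fun x => ((scalar_abs (h x) `^ q)%:E * (EFin \o u) x)%E).
Proof.
move=> mh; apply: emeasurable_funM; apply/measurable_EFinP => //.
apply: (measurableT_comp (measurable_powR _)).
exact: scalar_measurable_abs.
Qed.

(* c is exempted because the step map lives on [c, d[, chi_(c,d) H_2 on ]c, d[. *)
Lemma wLp_norm_le_itv h (K : R) : scalar_measurable I h -> 0 <= K ->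
  (forall x, I x -> x != c -> ~ `]c, d[%classic x -> h x = 0) ->
  (forall x, `]c, d[%classic x -> scalar_abs (h x) <= K) ->
  (wLp_norm Y h <= Umass u c d `^ q^-1 * K%:E)%E.
Proof.
move=> mh K0 h0 hK; have mhq := measurable_wLp_integrand mh.
have -> : K%:E = ((K `^ q)%:E `^ q^-1)%E.
  by rewrite poweR_EFin -powRrM mulfV ?gt_eqF// powRr1.
rewrite -poweRM ?Umass_ge0 ?lee_fin ?powR_ge0//.
apply: le_poweR; first by rewrite invr_ge0 ltW.
  apply: integral_ge0 => x Ix.
  by rewrite mule_ge0 ?lee_fin ?powR_ge0 ?u_ge0.
rewrite (@integral_setD_null _ _ [set c])//=; last exact: lebesgue_measure_set1.
rewrite (_ : (\int[mu]_(x in I `\ c) _)%E = (\int[mu]_(x in `]c, d[)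
    ((scalar_abs (h x) `^ q)%:E * (u x)%:E))%E); last first.
  rewrite -[in RHS](setIidr (_ : `]c, d[%classic `<=` I `\ c)); last first.
    move=> x xcd; split; first exact: cdI.
    by move=> /= xc; move: xcd; rewrite xc /= in_itv/= ltxx.
  rewrite [RHS]integral_mkcondr; apply: eq_integral => x /set_mem[Ix /= /eqP xc].
  rewrite patchE; case: ifPn => // /negP xcd.
  rewrite h0// ?scalar_abs0 ?powR0 ?gt_eqF ?mul0e//.
  by move=> xcd'; apply: xcd; rewrite inE.
rewrite muleC /Umass -ge0_integralZl; last 4 first.
- exact: measurable_itv.
- by apply/measurable_EFinP; exact: measurable_funS u_meas.
- by move=> x /cdI Ix; rewrite lee_fin u_ge0.
- by rewrite lee_fin powR_ge0.
apply: ge0_le_integral => //.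
- by move=> x /cdI Ix; rewrite mule_ge0 ?lee_fin ?powR_ge0 ?u_ge0.
- exact: (measurable_funS mI cdI mhq).
- apply: emeasurable_funM => //.
  by apply/measurable_EFinP; exact: measurable_funS u_meas.
- move=> x xcd; rewrite lee_wpmul2r ?lee_fin ?u_ge0//; first exact: cdI.
  by rewrite ge0_ler_powR ?nnegrE ?scalar_abs_ge0 ?hK// ltW.
Qed.

(** * The truncated operator *)

Lemma hardy2_on_measurable f g : in_wLp X1 f -> in_wLp X2 g ->
  scalar_measurable I (H2cd f g).
Proof.
move=> Xf Xg.
have mf := hardy_measurable p1_gt1 p1_conj v1_meas v1_pos V1_fin Xf Ic Id (ltW cd).
have mg := hardy_measurable p2_gt1 p2_conj v2_meas v2_pos V2_fin Xg Ic Id (ltW cd).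
have [mr mi] := scalar_measurableM mf mg.
(* Here r is the real or the imaginary part; r 0 = 0 lets it commute with extension by zero from ]c,
   d[ to I. *)
have key (r : scalars R k -> R) : r 0 = 0 ->
    measurable_fun `]c, d[%classic (fun x => r (hardy a f x * hardy a g x)) ->
    measurable_fun I (fun x => r (H2cd f g x)).
  move=> r0 mfg; rewrite (_ : (fun x => _) =
      (fun x => r (hardy a f x * hardy a g x)) \_ `]c, d[%classic).
    apply/measurable_restrict => //.
    by apply: measurable_funS mfg => // x [].
  apply/funext => x; rewrite patchE /hardy2_on indicE.
  by case: ifPn; rewrite ?mul1r ?mul0r.
by split; apply: key => //; case: k.
Qed.

Let hardy1_le := @hardy_le_right _ k _ _ _ _ _ p1_gt1 p1_conj v1_meas v1_pos _ _ Ic Id.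
Let hardy2_le := @hardy_le_right _ k _ _ _ _ _ p2_gt1 p2_conj v2_meas v2_pos _ _ Ic Id.
Let diff1_le := @hardy_diff_modulus _ k _ _ _ _ _ p1_gt1 p1_conj v1_meas v1_pos V1_fin _ _ Ic Id.
Let diff2_le := @hardy_diff_modulus _ k _ _ _ _ _ p2_gt1 p2_conj v2_meas v2_pos V2_fin _ _ Ic Id.
Let modulus1_lty := modulus_lty p1_gt1 p1_conj v1_meas V1_fin Ic Id.
Let modulus2_lty := modulus_lty p2_gt1 p2_conj v2_meas V2_fin Ic Id.
Let V1_lty := Vfun_poweR_lty V1_fin Id.
Let V2_lty := Vfun_poweR_lty V2_fin Id.
Local Notation M1 := (fine (Vfun a p1' v1 d `^ p1'^-1)%E).
Local Notation M2 := (fine (Vfun a p2' v2 d `^ p2'^-1)%E).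

Let M1E : M1%:E = (Vfun a p1' v1 d `^ p1'^-1)%E.
Proof. by rewrite fineK// ge0_fin_numE ?poweR_ge0. Qed.

Let M2E : M2%:E = (Vfun a p2' v2 d `^ p2'^-1)%E.
Proof. by rewrite fineK// ge0_fin_numE ?poweR_ge0. Qed.

Lemma hardy2_abs_le f g x y : in_wLp X1 f -> in_wLp X2 g -> c <= x <= d ->
  c <= y <= d -> scalar_abs (hardy a f x * hardy a g y) <=
  fine (wLp_norm X1 f) * M1 * (fine (wLp_norm X2 g) * M2).
Proof.
move=> Xf Xg xcd ycd; rewrite scalar_absM ler_pM ?scalar_abs_ge0//.
  rewrite -lee_fin EFinM M1E fineK; first exact: hardy1_le.
  by rewrite ge0_fin_numE ?wLp_norm_ge0//; case: Xf.
rewrite -lee_fin EFinM M2E fineK; first exact: hardy2_le.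
by rewrite ge0_fin_numE ?wLp_norm_ge0//; case: Xg.
Qed.

Lemma oscillation_ge0 r : 0 <= r -> (0 <= osc r)%E.
Proof.
by move=> r0; rewrite adde_ge0// mule_ge0 ?poweR_ge0// modulus_ge0// ltW.
Qed.

Lemma oscillation_lty r : 0 <= r -> (osc r < +oo)%E.
Proof.
move=> r0; rewrite lte_add_pinfty// lte_mul_pinfty ?poweR_ge0//.
- by rewrite -M1E.
- by rewrite -M2E.
Qed.

(** The increment of a product, split with Hf taken at x and Hg at y: each term is one value times
    one increment, giving M_1 w_2 + M_2 w_1 without a term w_1 w_2. *)
Lemma hardy2_diff_le f g x y r : in_wLp X1 f -> in_wLp X2 g ->
  (wLp_norm X1 f <= 1)%E -> (wLp_norm X2 g <= 1)%E ->
  c <= y -> y <= x -> x <= d -> x - y <= r ->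
  ((scalar_abs (hardy2 a f g x - hardy2 a f g y))%:E <= osc r)%E.
Proof.
move=> Xf Xg f1 g1 cy yx xd xyr.
have cx : c <= x <= d by rewrite xd (le_trans cy).
have yd : c <= y <= d by rewrite cy (le_trans yx).
have unit (Z : wLp R) h (m : \bar R) : (wLp_norm Z h <= 1)%E -> (0 <= m)%E ->
    (wLp_norm Z h * m <= m)%E.
  by move=> h1 m0; rewrite -[leRHS]mul1e lee_wpmul2r.
have -> : hardy2 a f g x - hardy2 a f g y =
    hardy a f x * (hardy a g x - hardy a g y) +
    hardy a g y * (hardy a f x - hardy a f y).
  by rewrite /hardy2; ring.
have r0 : 0 <= r by apply: le_trans xyr; rewrite subr_ge0.
apply: (@le_trans _ _
    ((scalar_abs (hardy a f x))%:E * (scalar_abs (hardy a g x - hardy a g y))%:E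
    + (scalar_abs (hardy a g y))%:E * (scalar_abs (hardy a f x - hardy a f y))%:E)%E).
  by rewrite -!EFinM -EFinD lee_fin -!scalar_absM scalar_absD.
apply: leeD; apply: lee_pmul; rewrite ?lee_fin ?scalar_abs_ge0//.
- exact: (le_trans (hardy1_le Xf cx) (unit _ _ _ f1 (poweR_ge0 _ _))).
- exact: (le_trans (diff2_le Xg cy yx xd xyr) (unit _ _ _ g1 (modulus_ge0 _ _ (ltW cd) r0))).
- exact: (le_trans (hardy2_le Xg yd) (unit _ _ _ g1 (poweR_ge0 _ _))).
- exact: (le_trans (diff1_le Xf cy yx xd xyr) (unit _ _ _ f1 (modulus_ge0 _ _ (ltW cd) r0))).
Qed.

(** On ]c, d[ the product is at most |f| M_1 |g| M_2 (norms in X_1, X_2), and u has finite mass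
    there; boundedness of H_2 is not assumed. *)
Lemma hardy2_on_in f g : in_wLp X1 f -> in_wLp X2 g -> in_wLp Y (H2cd f g).
Proof.
move=> Xf Xg; have mT := hardy2_on_measurable Xf Xg; split => //.
apply: (@le_lt_trans _ _ (Umass u c d `^ q^-1 *
    (fine (wLp_norm X1 f) * M1 * (fine (wLp_norm X2 g) * M2))%:E)%E).
  apply: wLp_norm_le_itv => //.
  - by rewrite !mulr_ge0 ?fine_ge0 ?wLp_norm_ge0 ?poweR_ge0.
  - move=> x _ _ xcd; rewrite /hardy2_on indicE memNset ?mul0r//.
  - move=> x xcd; rewrite /hardy2_on indicE mem_set// mul1r.
    by move: xcd; rewrite /= in_itv/= => /andP[cx xd];
      apply: hardy2_abs_le => //; rewrite !ltW.
by rewrite lte_mul_pinfty ?poweR_ge0 ?ltry// ge0_fin_numE ?poweR_ge0// poweR_lty// Umass_lty.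
Qed.

Let linear1 := @hardy_linear _ k _ _ _ _ _ p1_gt1 p1_conj v1_meas v1_pos V1_fin.
Let linear2 := @hardy_linear _ k _ _ _ _ _ p2_gt1 p2_conj v2_meas v2_pos V2_fin.
Let hardy1_eq := @hardy_wLp_eq _ k a b p1 _ v1_meas v1_pos.
Let hardy2_eq := @hardy_wLp_eq _ k a b p2 _ v2_meas v2_pos.

Lemma hardy2_on_bilinear : bilinear_map X1 X2 Y H2cd.
Proof.
split; first exact: hardy2_on_in.
- move=> f f' g g' Xf Xf' Xg Xg' ff gg; apply: wLp_eq_eqfun => x Ix.
  by rewrite /hardy2_on /hardy2 (hardy1_eq Xf Xf' ff Ix) (hardy2_eq Xg Xg' gg Ix).
- move=> s f f' g Xf Xf' Xg; apply: wLp_eq_eqfun => x Ix.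
  by rewrite /hardy2_on /hardy2 (linear1 s Xf Xf' Ix); ring.
- move=> s f g g' Xf Xg Xg'; apply: wLp_eq_eqfun => x Ix.
  by rewrite /hardy2_on /hardy2 (linear2 s Xg Xg' Ix); ring.
Qed.

(** * The step map of a fixed partition *)

Section given_partition.
Context (P : seq R).
Hypothesis cdP : itv_partition c d P.
Local Notation F := (@step_map R k a c P).

Let node_cd (j : 'I_(size P)) : c <= node c P j <= d.
Proof. by apply: node_bounds cdP _; exact: ltnW. Qed.

Let node_I (j : 'I_(size P)) : I (node c P j).
Proof. exact: (itv_subI Ic Id). Qed.

Lemma step_map_cell f g x : c <= x < d -> exists j : 'I_(size P),
  node c P j <= x < node c P j.+1 /\ F f g x = hardy2 a f g (node c P j).
Proof.
move=> cxd; have [j jx] := node_exists cdP cxd; exists j; split => //.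
rewrite /step_map (bigD1 j)//= indicE mem_set ?in_itv// mulr1 big1 ?addr0// => i ij.
rewrite indicE memNset ?mulr0//= in_itv/= => ix.
by move/eqP: ij; apply; exact: (node_unique cdP ix jx).
Qed.

Lemma step_map_out f g x : ~~ (c <= x < d) -> F f g x = 0.
Proof.
move=> xcd; rewrite /step_map big1// => j _; rewrite indicE memNset ?mulr0//=.
rewrite in_itv/= => /andP[jx xj]; move/negP: xcd; apply.
have /andP[cj _] := node_cd j.
have /andP[_ jd] := node_bounds cdP (ltn_ord j).
by rewrite (le_trans cj)// (lt_le_trans xj).
Qed.

Lemma step_map_measurable f g : scalar_measurable I (F f g).
Proof.
apply: scalar_measurable_sum => j; apply: scalar_measurableM.
  exact: scalar_measurable_cst.
exact: scalar_measurable_indic.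
Qed.

Lemma step_map_norm_le f g : in_wLp X1 f -> in_wLp X2 g ->
  (wLp_norm Y (F f g) <= Umass u c d `^ q^-1 *
    (fine (wLp_norm X1 f) * M1 * (fine (wLp_norm X2 g) * M2))%:E)%E.
Proof.
move=> Xf Xg; apply: wLp_norm_le_itv.
- exact: step_map_measurable.
- by rewrite !mulr_ge0 ?fine_ge0 ?wLp_norm_ge0 ?poweR_ge0.
- move=> x _ xc xcd; apply: step_map_out; apply/negP => /andP[cx xd].
  by apply: xcd; rewrite /= in_itv/= xd lt_neqAle eq_sym xc cx.
- move=> x; rewrite /= in_itv/= => /andP[/ltW cx xd].
  have [|j [_ ->]] := @step_map_cell f g x; first by rewrite cx.
  exact: hardy2_abs_le.
Qed.

Lemma step_map_bounded : bounded_bilinear X1 X2 Y F.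
Proof.
have U_lty K : (Umass u c d `^ q^-1 * K%:E < +oo)%E.
  by rewrite lte_mul_pinfty ?poweR_ge0 ?ltry// ge0_fin_numE ?poweR_ge0//
    poweR_lty// Umass_lty.
split; first split.
- move=> f g Xf Xg; split; first exact: step_map_measurable.
  exact: le_lt_trans (step_map_norm_le Xf Xg) (U_lty _).
- move=> f f' g g' Xf Xf' Xg Xg' ff gg; apply: wLp_eq_eqfun => x Ix.
  by apply: eq_bigr => j _; rewrite (hardy1_eq Xf Xf' ff)// (hardy2_eq Xg Xg' gg).
- move=> s f f' g Xf Xf' Xg; apply: wLp_eq_eqfun => x Ix.
  rewrite /step_map mulr_sumr -big_split; apply: eq_bigr => j _ /=.
  by rewrite (linear1 s Xf Xf')//; ring.
- move=> s f g g' Xf Xg Xg'; apply: wLp_eq_eqfun => x Ix.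
  rewrite /step_map mulr_sumr -big_split; apply: eq_bigr => j _ /=.
  by rewrite (linear2 s Xg Xg')//; ring.
apply: (le_lt_trans _ (U_lty (M1 * M2))).
apply: ub_ereal_sup => z [f [g [Xf Xg f1 g1 ->]]].
apply: (le_trans (step_map_norm_le Xf Xg)); apply: lee_wpmul2l.
  exact: poweR_ge0.
have fine1 (Z : wLp R) h : (wLp_norm Z h <= 1)%E -> fine (wLp_norm Z h) <= 1.
  move=> h1; rewrite -lee_fin fineK// ge0_fin_numE ?wLp_norm_ge0//.
  by rewrite (le_lt_trans h1) ?ltry.
rewrite lee_fin ler_pM ?mulr_ge0 ?fine_ge0 ?wLp_norm_ge0 ?poweR_ge0//.
  by rewrite ler_piMl ?fine_ge0 ?poweR_ge0// fine1.
by rewrite ler_piMl ?fine_ge0 ?poweR_ge0// fine1.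
Qed.

(** An element of the span is constant on each cell, with coefficient its value at the left node.
    The indicators themselves may lie outside the span, which [has_rank_le] permits. *)
Lemma step_map_rank : exists2 r : nat, has_rank X1 X2 Y F r & (r <= size P)%N.
Proof.
apply: (@has_rank_le _ _ _ _ _ _ _
  (fun j x => \1_(`[node c P j, node c P j.+1[%classic) x)).
move=> h [n [s [f [g [_ ->]]]]].
exists (fun j => \sum_(i < n) s i * hardy2 a (f i) (g i) (node c P j)) => x.
under eq_bigr do rewrite mulr_sumr.
rewrite exchange_big/=; apply: eq_bigr => j _; rewrite mulr_suml.
by apply: eq_bigr => i _; rewrite mulrA.
Qed.

(** A point of a cell is within the mesh, hence within r, of the left node, so [hardy2_diff_le]
    bounds the difference pointwise on ]c, d[. *)
Lemma step_map_error r f g : mesh c P <= r -> in_wLp X1 f -> in_wLp X2 g ->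
  (wLp_norm X1 f <= 1)%E -> (wLp_norm X2 g <= 1)%E ->
  (wLp_norm Y (bilinear_sub H2cd F f g) <= Umass u c d `^ q^-1 * osc r)%E.
Proof.
move=> Pr Xf Xg f1 g1; have r0 : 0 <= r := le_trans (mesh_ge0 _ _) Pr.
have or : (fine (osc r))%:E = osc r.
  by rewrite fineK// ge0_fin_numE ?oscillation_lty ?oscillation_ge0.
rewrite -or; apply: wLp_norm_le_itv.
- apply: scalar_measurableD; first exact: hardy2_on_measurable.
  by apply: scalar_measurableN; exact: step_map_measurable.
- by rewrite fine_ge0// oscillation_ge0.
- move=> x _ xc xcd; rewrite /bilinear_sub step_map_out; last first.
    apply/negP => /andP[cx xd].
    by apply: xcd; rewrite /= in_itv/= xd lt_neqAle eq_sym xc cx.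
  by rewrite /hardy2_on indicE memNset// mul0r subrr.
- move=> x xcd; rewrite /bilinear_sub /hardy2_on indicE mem_set// mul1r.
  move: xcd; rewrite /= in_itv/= => /andP[/ltW cx xd].
  have [|j [/andP[jx xj] ->]] := @step_map_cell f g x; first by rewrite cx.
  rewrite -lee_fin or; apply: hardy2_diff_le => //; last 2 first.
  + exact: ltW.
  + by rewrite (le_trans _ Pr)// (le_trans _ (node_mesh c j))// lerB// ltW.
  by have /andP[] := node_cd j.
Qed.

Lemma step_map_error_norm :
  (bilinear_norm X1 X2 Y (bilinear_sub H2cd F) <=
   Ebound a p1' p2' q v1 v2 u c d P)%E.
Proof.
by apply: ub_ereal_sup => z [f [g [Xf Xg f1 g1 ->]]]; exact: step_map_error.
Qed.
End given_partition.

(** * Arbitrarily small error, and the full operator *)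

Lemma step_map_error_small (eps : R) : 0 < eps -> exists2 P : seq R,
  itv_partition c d P & (Ebound a p1' p2' q v1 v2 u c d P < eps%:E)%E.
Proof.
move=> eps0; pose U := fine (Umass u c d `^ q^-1)%E.
have UE : U%:E = (Umass u c d `^ q^-1)%E.
  by rewrite fineK// ge0_fin_numE ?poweR_ge0// poweR_lty// Umass_lty.
have U0 : 0 <= U by rewrite fine_ge0// poweR_ge0.
have M10 : 0 <= M1 by rewrite fine_ge0// poweR_ge0.
have M20 : 0 <= M2 by rewrite fine_ge0// poweR_ge0.
have D0 : 0 < U * (M1 + M2) + 1.
  by rewrite ltr_wpDl// mulr_ge0// addr_ge0.
(* The added 1 keeps the denominator positive when U (M_1 + M_2) = 0 and makes the final inequality
   strict. *)
pose e := eps / (U * (M1 + M2) + 1).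
have e0 : 0 < e by rewrite divr_gt0.
have eE : U * ((M1 + M2) * e) < eps.
  by rewrite mulrA /e mulrA ltr_pdivrMr// [ltRHS]mulrC ltr_pM2r// ltrDl.
clearbody e.
have [r1 r10 r1E] := modulus_small p1_gt1 p1_conj v1_meas V1_fin Ic Id e0.
have [r2 r20 r2E] := modulus_small p2_gt1 p2_conj v2_meas V2_fin Ic Id e0.
have r0 : 0 < Num.min r1 r2 by rewrite lt_min r10.
have [m m0 mr] : exists2 m, (0 < m)%N & (d - c) / m%:R <= Num.min r1 r2.
  (* The successor of the integer part exceeds (d - c)/min(r1, r2), so the uniform step is below
     both thresholds. *)
  exists (Num.truncn ((d - c) / Num.min r1 r2)).+1 => //.
  rewrite ler_pdivrMr ?ltr0n// mulrC -ler_pdivrMr//.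
  exact/ltW/truncnS_gt.
exists (uniform_partition c d m); first exact: itv_partition_uniform.
have mesh_r := le_trans (mesh_uniform_partition cd m0) mr.
have mesh_r1 : mesh c (uniform_partition c d m) <= r1.
  by rewrite (le_trans mesh_r)// ge_min lexx.
have mesh_r2 : mesh c (uniform_partition c d m) <= r2.
  by rewrite (le_trans mesh_r)// ge_min lexx orbT.
apply: (@le_lt_trans _ _ (U%:E * (M1%:E * e%:E + M2%:E * e%:E))%E).
  rewrite UE M1E M2E; apply: lee_wpmul2l; first exact: poweR_ge0.
  apply: leeD; apply: lee_wpmul2l; rewrite ?poweR_ge0//.
    exact: le_trans (le_modulus _ _ _ _ mesh_r2) r2E.
  exact: le_trans (le_modulus _ _ _ _ mesh_r1) r1E.
rewrite (_ : (_ * _)%E = (U * (M1 * e + M2 * e))%:E); last first.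
  by rewrite EFinM EFinD !EFinM.
by rewrite lte_fin -mulrDl.
Qed.

(** The hypothesis that H_2 maps into Y supplies measurability of H_2(f, g) on all of I, where the
    estimates on [c, d] say nothing. *)
Lemma hardy2_error_le P r : itv_partition c d P -> mesh c P <= r ->
  bilinear_map X1 X2 Y (@hardy2 R k a) ->
  (bilinear_norm X1 X2 Y (bilinear_sub (@hardy2 R k a) (@step_map R k a c P)) <=
   (gamma_tail k a b X1 X2 Y c d `^ q + Umass u c d * osc r `^ q) `^ q^-1)%E.
Proof.
move=> cdP Pr H2; have r0 : 0 <= r := le_trans (mesh_ge0 _ _) Pr.
apply: ub_ereal_sup => z [f [g [Xf Xg f1 g1 ->]]].
have [mH2 _] := bilinear_map_in H2 Xf Xg.
have mF := step_map_measurable P f g.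
have mH2F : scalar_measurable I
    (bilinear_sub (@hardy2 R k a) (@step_map R k a c P) f g).
  by apply: scalar_measurableD => //; exact: scalar_measurableN.
pose A := eitv a c%:E `|` eitv d%:E b.
have mA : measurable A by apply: measurableU; exact: measurable_eitv.
have AI : A `<=` I.
  move=> x [/andP[ax xc]|/andP[dx xb]]; apply/andP; split => //.
    by apply: (lt_trans xc); have /andP[] := Ic.
  by apply: lt_trans dx; have /andP[] := Id.
have mHA : scalar_measurable I (hardy2_on a A f g).
  by apply: scalar_measurableM => //; exact: scalar_measurable_indic.
have poweRK (t : \bar R) : (0 <= t)%E -> ((t `^ q^-1) `^ q = t)%E.
  by move=> t0; rewrite -poweRrM mulVf ?gt_eqF// poweRe1.
have ge0 h x : I x -> (0 <= (scalar_abs (h x) `^ q)%:E * (u x)%:E)%E.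
  by move=> Ix; rewrite mule_ge0 ?lee_fin ?powR_ge0 ?u_ge0.
have q0 : 0 <= q by exact: ltW.
apply: le_poweR; first by rewrite invr_ge0.
  by apply: integral_ge0 => x Ix; exact: ge0.
(* The points c and d lie neither in A nor in ]c, d[, and the step map may be nonzero at c; both are
   dropped as null. *)
have N0 : mu [set c; d] = 0%E.
  by apply: countable_lebesgue_measure0; exact/finite_set_countable/finite_set2.
have mN : measurable [set c; d] by exact: measurableU.
rewrite (@integral_setD_null _ _ [set c; d])//=; last first.
  exact: (measurable_wLp_integrand mH2F).
have IE : I `\` [set c; d] = A `|` `]c, d[%classic.
  apply/seteqP; split => x.
    move=> [/andP[ax xb]] /= /not_orP[/eqP xc /eqP xd].
    have [cx|cx|xc'] := ltgtP x c; last by rewrite xc' eqxx in xc.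
      by left; left; apply/andP; rewrite lte_fin.
    have [dx|dx|xd'] := ltgtP x d; last by rewrite xd' eqxx in xd.
      by right; rewrite /= in_itv/= cx.
    by left; right; apply/andP; rewrite lte_fin.
  case=> [Ax|xcd].
    split; first exact: AI.
    by move=> [] /= xE; move: Ax; rewrite xE => -[] /andP[]; rewrite !lte_fin ?ltxx// => h1 h2;
      [have := lt_trans cd h1|have := lt_trans cd h2]; rewrite ?ltxx//;
      move: cd h1 h2; rewrite ltNge => /negP + *; case; exact: ltW.
  split; first exact: cdI.
  by move: xcd; rewrite /= in_itv/= => /andP[cx xd] [] xE; move: cx xd;
    rewrite xE ltxx.
have Acd : [disjoint A & `]c, d[%classic].
  apply/disj_set2P/seteqP; split => // x [Ax]; rewrite /= in_itv/= => /andP[cx xd].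
  by case: Ax => /andP[]; rewrite !lte_fin => h1 h2;
    [move: h2; rewrite ltNge (ltW cx)|move: h1; rewrite ltNge (ltW xd)].
rewrite IE ge0_integral_setU//=; last 2 first.
- rewrite -IE; apply: (measurable_funS mI) (measurable_wLp_integrand mH2F).
  exact: subDsetl.
- by move=> x Ax; apply: ge0; have [] : (I `\` [set c; d]) x by rewrite IE.
apply: leeD.
  (* On A the step map vanishes, so the difference is chi_A H_2, whose norm at f, g in the unit
     balls is at most gamma(c, d). *)
  have := poweRK (\int[mu]_(x in I)
    ((scalar_abs (hardy2_on a A f g x) `^ q)%:E * (u x)%:E))%E.
  rewrite integral_ge0 => [/(_ isT) E|x Ix]; last exact: ge0.
  apply: (@le_trans _ _ (wLp_norm Y (hardy2_on a A f g) `^ q)%E); last first.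
    apply: le_poweR; rewrite ?wLp_norm_ge0//; apply: ereal_sup_ubound.
    by exists f, g.
  rewrite E; apply: (@le_trans _ _ (\int[mu]_(x in A)
    ((scalar_abs (hardy2_on a A f g x) `^ q)%:E * (u x)%:E))%E); last first.
    have mHAq := measurable_wLp_integrand mHA.
    by apply: ge0_subset_integral => //; exact: ge0.
  rewrite le_eqVlt; apply/orP; left; apply/eqP; apply: eq_integral => x /set_mem Ax.
  rewrite /bilinear_sub step_map_out//; last first.
    apply/negP => /andP[cx xd]; case: Ax => /andP[]; rewrite !lte_fin.
      by move=> _; rewrite ltNge cx.
    by rewrite ltNge (ltW xd).
  by rewrite subr0 /hardy2_on indicE mem_set// mul1r.
(* On ]c, d[ the operator agrees with its truncation, so [step_map_error] applies to h; U is
   rewritten as (U^(1/q))^q to compare q-th powers. *)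
pose h := bilinear_sub H2cd (@step_map R k a c P) f g.
have mh : scalar_measurable I h.
  apply: scalar_measurableD; first exact: hardy2_on_measurable.
  exact: scalar_measurableN.
rewrite -(poweRK (Umass u c d)) ?Umass_ge0//.
rewrite -poweRM ?poweR_ge0 ?oscillation_ge0//.
apply: (@le_trans _ _ (wLp_norm Y h `^ q)%E); last first.
  by apply: le_poweR; rewrite ?wLp_norm_ge0//; exact: step_map_error.
rewrite /wLp_norm/= poweRK; last by apply: integral_ge0 => x Ix; exact: ge0.
apply: (@le_trans _ _ (\int[mu]_(x in `]c, d[)
  ((scalar_abs (h x) `^ q)%:E * (u x)%:E))%E); last first.
  have mhq := measurable_wLp_integrand mh.
  by apply: ge0_subset_integral => //; exact: ge0.
rewrite le_eqVlt; apply/orP; left; apply/eqP; apply: eq_integral => x xcd.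
by rewrite /h /bilinear_sub /hardy2_on indicE xcd mul1r.
Qed.

End step_approximation.

Theorem proposition4p3 (R : realType) (k : scalar_kind) (a b : \bar R)
  (p1 p2 p1' p2' q : R) (v1 v2 : R -> \bar R) (u : R -> R)
  (I := eitv a b)
  (X1 := WLp I p1 v1) (X2 := WLp I p2 v2) (Y := WLp I q (EFin \o u))
  (H2 := @hardy2 R k a)
  (ab : (a < b)%E)
  (p1_gt1 : 1 < p1) (p2_gt1 : 1 < p2) (q_gt0 : 0 < q)
  (p1_conj : 1 / p1 + 1 / p1' = 1) (p2_conj : 1 / p2 + 1 / p2' = 1)
  (v1_meas : measurable_fun I v1) (v2_meas : measurable_fun I v2)
  (v1_pos : {ae lebesgue_measure, forall x : R, I x -> (0 < v1 x < +oo)%E})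
  (v2_pos : {ae lebesgue_measure, forall x : R, I x -> (0 < v2 x < +oo)%E})
  (u_ge0 : forall x : R, I x -> 0 <= u x)
  (u_loc : locally_integrable I u)
  (V1_fin : forall x : R, I x -> (Vfun a p1' v1 x < +oo)%E)
  (V2_fin : forall x : R, I x -> (Vfun a p2' v2 x < +oo)%E)
  (c d : R) (ac : (a < c%:E)%E) (cd : c < d) (db : (d%:E < b)%E)
  (H2cd := @hardy2_on R k a `]c, d[%classic) :
  [/\ bilinear_map X1 X2 Y H2cd,
      forall P : seq R, itv_partition c d P ->
        [/\ bounded_bilinear X1 X2 Y (@step_map R k a c P),
            exists2 r : nat,
              has_rank X1 X2 Y (@step_map R k a c P) r & (r <= size P)%N &
            (bilinear_norm X1 X2 Y
               (bilinear_sub H2cd (@step_map R k a c P))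
             <= Ebound a p1' p2' q v1 v2 u c d P)%E],
      forall eps : R, 0 < eps ->
        exists P : seq R,
        [/\ itv_partition c d P,
            bounded_bilinear X1 X2 Y (@step_map R k a c P),
            finite_rank X1 X2 Y (@step_map R k a c P) &
            (bilinear_norm X1 X2 Y
               (bilinear_sub H2cd (@step_map R k a c P)) < eps%:E)%E] &
      bounded_bilinear X1 X2 Y H2 ->
        (forall P : seq R, itv_partition c d P ->
           (approx_number X1 X2 Y (size P).+1 H2 <=
            (gamma_tail k a b X1 X2 Y c d `^ q +
             Ebound a p1' p2' q v1 v2 u c d P `^ q) `^ q^-1)%E) /\
        (forall m : nat, (0 < m)%N ->
           (approx_number X1 X2 Y m.+1 H2 <=
            (gamma_tail k a b X1 X2 Y c d `^ q +
             Umass u c d *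
             oscillation a p1' p2' v1 v2 c d ((d - c) / m%:R) `^ q)
            `^ q^-1)%E)].
Proof.
have bilin := hardy2_on_bilinear k p1_gt1 p2_gt1 q_gt0 p1_conj p2_conj v1_meas
  v2_meas v1_pos v2_pos u_ge0 u_loc V1_fin V2_fin ac cd db.
have bdd := step_map_bounded k p1_gt1 p2_gt1 q_gt0 p1_conj p2_conj v1_meas
  v2_meas v1_pos v2_pos u_ge0 u_loc V1_fin V2_fin ac cd db.
have err := step_map_error_norm k p1_gt1 p2_gt1 q_gt0 p1_conj p2_conj v1_meas
  v2_meas v1_pos v2_pos u_ge0 u_loc V1_fin V2_fin ac cd db.
have full := hardy2_error_le (k := k) p1_gt1 p2_gt1 q_gt0 p1_conj p2_conj v1_meas
  v2_meas v1_pos v2_pos u_ge0 u_loc V1_fin V2_fin ac cd db.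
split.
- exact: bilin.
- by move=> P cdP; split; [exact: bdd|exact: step_map_rank|exact: err].
- move=> eps eps0.
  have [P cdP Pe] := step_map_error_small q p1_gt1 p2_gt1 p1_conj p2_conj v1_meas
    v2_meas u_ge0 u_loc V1_fin V2_fin ac cd db eps0.
  exists P; split => //; first exact: bdd.
    by have [r rF _] := step_map_rank k a b p1 p2 q v1 v2 u c P; exists r.
  exact: le_lt_trans (err P cdP) Pe.
move=> [H2bil _].
(* The step map has rank at most [size P], strictly below the index [(size P).+1], so it competes in
   the infimum. The free r serves both final bounds. *)
have approx P r : itv_partition c d P -> mesh c P <= r ->
    (approx_number X1 X2 Y (size P).+1 H2 <=
     (gamma_tail k a b X1 X2 Y c d `^ q +
      Umass u c d * oscillation a p1' p2' v1 v2 c d r `^ q) `^ q^-1)%E.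
  move=> cdP Pr; apply: (le_trans _ (full P r cdP Pr H2bil)).
  apply: ereal_inf_lbound; exists (@step_map R k a c P); split => //.
    exact: bdd.
  by have [r' rF rP] := step_map_rank k a b p1 p2 q v1 v2 u c P; exists r'.
split.
- move=> P cdP; have := approx P _ cdP (lexx _).
  (* The q-th power turns U^(1/q) into U, so E^q is the second summand of [approx] at r = |P|. *)
  rewrite /Ebound poweRM ?poweR_ge0//; last first.
    by apply: oscillation_ge0 => //; exact: mesh_ge0.
  rewrite -poweRrM mulVf ?gt_eqF// poweRe1//.
  exact: (Umass_ge0 u_ge0 ac cd db).
- move=> m m0.
  have := approx _ _ (itv_partition_uniform cd m0) (mesh_uniform_partition cd m0).
  by rewrite size_uniform_partition.
Qed.
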